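(* In the supersample setting described in the context, assume the loss takes values in $[0,1]$. Then \[ \left|\mathrm{Err}\right| \leq\frac{2}{n}\sum_{i=1}^n\sqrt{2I(L^+_{i};U_i)}\leq \frac{2}{n}\sum_{i=1}^n\sqrt{2I(f_W(X^+_{i});U_i\mid\widetilde{Z})}. \]
   Context: Let $\mathcal Z=\mathcal X\times\mathcal Y$ and let $\mu$ be a distribution on $\mathcal Z$. A (possibly randomized) learning algorithm $\mathcal A$ maps a training sample in $\mathcal Z^n$ to a hypothesis $W\in\mathcal W$; each $w$ defines a predictor $f_w:\mathcal X\to\mathcal Y$, and the loss depends on $w$ only through the prediction, i.e. $\ell(w,(x,y))=\tilde\ell(f_w(x),y)$ for some function $\tilde\ell$. For $S=(Z_1,\dots,Z_n)\sim\mu^{n}$ and $W\sim P_{W|S}$, let $L_\mu=\mathbb E_W\mathbb E_{Z'\sim\mu}[\ell(W,Z')]$ (with $Z'$ independent of $(S,W)$), $L_n=\mathbb E_{W,S}[\frac1n\sum_i\ell(W,Z_i)]$, $\mathrm{Err}=L_\mu-L_n$. Supersample: $\widetilde Z=(\widetilde Z_{i,j})_{i\in\{1,\dots,n\},j\in\{0,1\}}$ with i.i.d. entries of law $\mu$; $U=(U_1,\dots,U_n)$ uniform on $\{0,1\}^n$, independent of $\widetilde Z$; $W=\mathcal A(\widetilde Z_U)$ with $\widetilde Z_U=(\widetilde Z_{1,U_1},\dots,\widetilde Z_{n,U_n})$. Write $\widetilde Z_{i,0}=(X_i^+,Y_i^+)$ and $L_i^+=\ell(W,\widetilde Z_{i,0})$.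 Mutual information is in nats. *)

(* Defs.v *)
From HB Require Import structures.
From mathcomp Require Import all_boot all_order all_algebra.
From mathcomp Require Import all_classical all_reals all_analysis.
Set Implicit Arguments. Unset Strict Implicit. Unset Printing Implicit Defensive.
Import Order.TTheory GRing.Theory Num.Theory.
Local Open Scope classical_set_scope.
Local Open Scope ring_scope.

Section InfoTheory.
Context {R : realType}.

Definition is_density d (T : measurableType d) (P Q : set T -> \bar R)
    (f : T -> R) : Prop :=
  [/\ measurable_fun setT f, (forall x, 0 <= f x) &
      forall A, measurable A -> P A = (\int[Q]_(x in A) (f x)%:E)%E].

(* Kullback-Leibler divergence in nats: D(P||Q) = \int (dP/dQ) ln (dP/dQ) dQ
   if P << Q (i.e. a density exists), and +oo otherwise.  (ln 0 = 0 in
   mathcomp, giving the convention 0 ln 0 = 0.)  The value does not depend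
   on the chosen version of the density. *)
Definition KL d (T : measurableType d) (P Q : set T -> \bar R) : \bar R :=
  match pselect (exists f, is_density P Q f) with
  | left h => let f := projT1 (cid h) in
              (\int[Q]_x (f x * ln (f x))%:E)%E
  | right _ => +oo%E
  end.

Definition MI dO d1 d2 (O : measurableType dO) (T1 : measurableType d1)
    (T2 : measurableType d2) (P : set O -> \bar R) (A : O -> T1) (B : O -> T2)
    : \bar R :=
  KL (pushforward P (fun w => (A w, B w)))
     (pushforward P A \x pushforward P B)%E.

Definition cond_law dO d1 dZ (O : measurableType dO) (T : measurableType d1)
    (TZ : measurableType dZ) (P : set O -> \bar R) (Zv : O -> TZ)
    (AB : O -> T) (kappa : R.-pker TZ ~> T) : Prop :=
  forall C D, measurable C -> measurable D ->
    P (Zv @^-1` C `&` AB @^-1` D) =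
    (\int[P]_(w in Zv @^-1` C) kappa (Zv w) D)%E.

(* Conditional mutual information I(A;B | Zv), computed from a regular
   conditional distribution kappa of (A,B) given Zv:
   E_{Zv}[ D(P_{(A,B)|Zv} || P_{A|Zv} (x) P_{B|Zv}) ]. *)
Definition CMI dO d1 d2 dZ (O : measurableType dO) (T1 : measurableType d1)
    (T2 : measurableType d2) (TZ : measurableType dZ) (P : set O -> \bar R)
    (Zv : O -> TZ) (kappa : R.-pker TZ ~> (T1 * T2)%type) : \bar R :=
  (\int[P]_w KL (kappa (Zv w))
      (pushforward (kappa (Zv w)) fst \x pushforward (kappa (Zv w)) snd))%E.

Definition mutual_indep dO (O : measurableType dO) (P : set O -> \bar R)
    (I : finType) (F : I -> set (set O)) : Prop :=
  forall (J : {set I}) (E : I -> set O), (forall i, i \in J -> F i (E i)) ->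
    P (\big[setI/setT]_(i in J) E i) = (\prod_(i in J) P (E i))%E.

End InfoTheory.

Section Supersample.
Context {R : realType} {dX dY : measure_display}
  {X : measurableType dX} {Y : measurableType dY} {n : nat}.

Definition select_sample (z : n.-tuple ((X * Y) * (X * Y))) (u : n.-tuple bool)
    : n.-tuple (X * Y) :=
  [tuple (if tnth u i then (tnth z i).2 else (tnth z i).1) | i < n].

Definition zcomp dO (O : measurableType dO) (Zt : O -> n.-tuple ((X*Y)*(X*Y)))
    (i : 'I_n) (b : bool) : O -> X * Y :=
  fun w => if b then (tnth (Zt w) i).2 else (tnth (Zt w) i).1.

Definition supersample_model dO dW (O : measurableType dO)
    (Wt : measurableType dW) (P : probability O R)
    (mu : probability (X * Y)%type R)
    (Alg : R.-pker (n.-tuple (X * Y)%type) ~> Wt)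
    (Zt : O -> n.-tuple ((X * Y) * (X * Y))) (U : O -> n.-tuple bool)
    (W : O -> Wt) : Prop :=
  [/\ mutual_indep P (fun k : 'I_n * option bool =>
        match k.2 with
        | Some b => [set zcomp Zt k.1 b @^-1` A | A in measurable]
        | None => [set (fun w => tnth (U w) k.1) @^-1` A | A in [set: set bool]]
        end),
      (forall i b A, measurable A -> P (zcomp Zt i b @^-1` A) = mu A),
      (forall i, P ((fun w => tnth (U w) i) @^-1` [set true]) = (2^-1)%:E) &
      (forall C B, measurable C -> measurable B ->
         P ((fun w => (Zt w, U w)) @^-1` C `&` W @^-1` B) =
         (\int[P]_(w in (fun w => (Zt w, U w)) @^-1` C)
            Alg (select_sample (Zt w) (U w)) B)%E)].

End Supersample.

(* Main.v *)
Require Import Defs.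
From HB Require Import structures.
From mathcomp Require Import all_boot all_order all_algebra.
From mathcomp Require Import all_classical all_reals all_analysis.
From mathcomp Require Import measurable_realfun ring lra.
(** Under [U_i = 1] the point [Z_{i,0}] is independent of [W], and under
    [U_i = 0] it is a training point, so
    [E[1_{U_i=1} L_i] = L_mu / 2] and [E[1_{U_i=0} L_i] = E[l(W, S_i)] / 2]
    (with [S] the training sample), whence
    [Err = (2/n) sum_i E[(1_{U_i=1} - 1_{U_i=0}) L_i]].
    The integrand vanishes in mean under the product of the marginals of
    [(L_i, U_i)], and Pinsker's inequality bounds each term by
    [sqrt (2 I(L_i; U_i))].

    For the second inequality let [h <= 2] be the density of the law of
    [(L_i, U_i)] with respect to the product of its marginals.  Given
    [Z~ = z], the pair [(L_i, U_i)] is a function of [(f_W(X_i), U_i)], and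
    testing the conditional divergence against [ln (h + e)] gives
    [KL_z >= E[ln (h + e) | z] + 1 - int (h + e) dQ_z], where [Q_z] is the
    product of the conditional marginals.  Since [U_i] is independent of [Z~],
    the [Q_z] average to the product of the unconditional marginals, and the
    right-hand side averages to at least [I(L_i; U_i) - e]. *)

Set Implicit Arguments. Unset Strict Implicit. Unset Printing Implicit Defensive.
Import Order.TTheory GRing.Theory Num.Theory.
Import numFieldNormedType.Exports HBNNSimple.
Local Open Scope classical_set_scope.
Local Open Scope ring_scope.

(** * Pointwise inequalities *)

(** The familiar route to the second inequality composes the chain rule with data processing under
    the conditional laws, and relies on densities of those laws that are jointly measurable in [z].
    To avoid choosing such densities, one test function, built from the unconditional density,
    serves for all [z] at once. This works because the variational bound is affine in the second
    measure, and so survives averaging over [z]. The bound [h <= 2] comes from the fair selector: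
    the product of the marginals gives each selector value mass 1/2, so the joint law is at most
    twice the product. Adding [e] keeps the test function away from 0, which makes its logarithm
    bounded; the price [e] is what it adds to the integral of [h]. A divergence may be infinite, so
    lower bounds on it only integrate minorants that are integrable by themselves. *)

Lemma mvt_pos (R : realType) (f df : R -> R) (t : R) : 0 < t ->
  (forall x : R, 0 < x -> is_derive x 1 f (df x)) ->
  exists2 c, 0 < c & f t - f 1 = df c * (t - 1) /\ 0 <= (t - 1) * (c - 1).
Proof.
move=> t0 fdf.
have cf (x : R) : 0 < x -> {for x, continuous f}.
  by move=> x0; apply: differentiable_continuous; apply/derivable1_diffP; have [] := fdf _ x0.
have [t1|t1] := leP 1 t.
- have [x /[!in_itv]/= /andP[x1 xt]||c /[!in_itv]/= /andP[c1 ct] fE] := @MVT_segment R f df 1 t t1.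
  + by apply: fdf; lra.
  + apply: continuous_in_subspaceT => y /[!inE]/= /[!in_itv]/= /andP[y1 _].
    by apply: cf; lra.
  + exists c; [lra|split => //]. by apply: mulr_ge0; lra.
- have [x /[!in_itv]/= /andP[x1 xt]||c /[!in_itv]/= /andP[c1 ct] fE] := @MVT_segment R f df t 1 (ltW t1).
  + by apply: fdf; lra.
  + apply: continuous_in_subspaceT => y /[!inE]/= /[!in_itv]/= /andP[y1 _].
    by apply: cf; lra.
  + exists c; [lra|split; first by lra]. by apply: mulr_le0; lra.
Qed.

(** The first factor vanishes at 1 and its derivative [ln x + 1/x - 1] is nonnegative, by
    [ln y <= y - 1] at [y = 1/x]; hence it has the sign of [t - 1]. The product form covers both
    sides of 1 in one statement. *)
Lemma ln_lower_secant (R : realType) (t : R) : 0 < t ->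
  0 <= ((t + 1) * ln t - 2 * (t - 1)) * (t - 1).
Proof.
move=> t0.
pose f (x : R) := (x + 1) * ln x - 2 * (x - 1).
pose df (x : R) := ln x + (x + 1) * x^-1 - 2.
have fd (x : R) : 0 < x -> is_derive x 1 f (df x).
  move=> x0; rewrite /f /df.
  have h := is_derive1_ln x0.
  apply: is_derive_eq; rewrite /GRing.scale/=; ring.
have [c c0 [ft _]] := mvt_pos t0 fd.
have -> : (t + 1) * ln t - 2 * (t - 1) = df c * (t - 1).
  by rewrite -ft /f ln1; ring.
rewrite -mulrA mulr_ge0 ?sqr_ge0 -?expr2// ?sqr_ge0//.
have := @le_ln1Dx R (c^-1 - 1); rewrite [1 + _]addrCA subrr addr0 lnV ?posrE//.
have : 0 < c^-1 by rewrite invr_gt0.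
move=> c1 /(_ ltac:(lra)); rewrite /df mulrDl mulfV ?gt_eqF// => ?; lra.
Qed.

(** The difference of the two sides vanishes at 1, and its derivative is four times the first factor
    of [ln_lower_secant]. With a probability density in place of [t], the weight [2 * t + 4]
    integrates to 6, and 6 / 3 is the constant 2 of Pinsker's inequality. *)
Lemma pinsker_pointwise (R : realType) (t : R) : 0 < t ->
  3 * (t - 1) ^+ 2 <= (2 * t + 4) * (t * ln t - t + 1).
Proof.
move=> t0.
pose f (x : R) := (2 * x + 4) * (x * ln x - x + 1) - 3 * (x - 1) ^+ 2.
pose df (x : R) := 4 * ((x + 1) * ln x - 2 * (x - 1)).
have fd (x : R) : 0 < x -> is_derive x 1 f (df x).
  move=> x0; rewrite /f /df.
  have h := is_derive1_ln x0.
  apply: is_derive_eq; rewrite /GRing.scale/=.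
  by field; rewrite gt_eqF.
have [c c0 [ft tc]] := mvt_pos t0 fd.
rewrite -subr_ge0.
have -> : (2 * t + 4) * (t * ln t - t + 1) - 3 * (t - 1) ^+ 2 = df c * (t - 1).
  by rewrite -ft /f ln1; ring.
have [c1|c1] := eqVneq c 1; first by rewrite /df c1 ln1; lra.
(* After multiplication by [(c - 1)^2 > 0], the sign of [df c] comes from [ln_lower_secant] at [c],
   and that of [t - 1] from [c] lying on the same side of 1 as [t]. *)
rewrite -(@pmulr_rge0 _ ((c - 1) ^+ 2)); last by rewrite exprn_even_gt0//= subr_eq0.
have -> : (c - 1) ^+ 2 * (df c * (t - 1)) =
  4 * (((c + 1) * ln c - 2 * (c - 1)) * (c - 1) * ((t - 1) * (c - 1))) by rewrite /df; ring.
by rewrite mulr_ge0// mulr_ge0// ln_lower_secant.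
Qed.

(* AM-GM applied to [pinsker_pointwise], with free parameter [c] *)
Lemma xlnx_ge_quadratic (R : realType) (c t : R) : 0 <= t ->
  t - 1 + 2 * c * (t - 1) - 2 / 3 * c ^+ 2 * (t + 2) <= t * ln t.
Proof.
rewrite le_eqVlt => /predU1P[<-|t0].
  have := sqr_ge0 (c + 3 / 4); rewrite mul0r expr2; nra.
have := pinsker_pointwise t0.
set u := t * ln t => H.
rewrite -(@ler_pM2l _ (2 * t + 4)); last by lra.
have := sqr_ge0 (3 * (t - 1) - c * (2 * t + 4)).
rewrite !expr2 in H *; lra.
Qed.

(* Fenchel-Young inequality for the conjugate pair [t ln t - t] and [exp] *)
Lemma xlnx_ge_affine (R : realType) (g t : R) : 0 < g -> 0 <= t ->
  t * ln g + t - g <= t * ln t.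
Proof.
move=> g0; rewrite le_eqVlt => /predU1P[<-|t0]; first by lra.
have := @le_ln1Dx R (g / t - 1); rewrite [1 + _]addrCA subrr addr0 ln_div ?posrE//.
have gt : 0 < g / t by rewrite divr_gt0.
move=> /(_ ltac:(lra)) H.
have : t * (ln g - ln t) <= t * (g / t - 1) by rewrite ler_pM2l.
by rewrite !mulrBr mulr1 [t * (g / t)]mulrCA mulfV ?gt_eqF//; lra.
Qed.

(* The Lebesgue integral of a nonnegative function is a supremum over simple
   functions, so monotonicity needs no measurability. *)
Lemma integral_mono d (T : measurableType d) (R : realType)
    (mu : {measure set T -> \bar R}) (f g : T -> \bar R) :
  (forall x, f x <= g x)%E -> (\int[mu]_x f x <= \int[mu]_x g x)%E.
Proof.
have ge0_mono (a b : T -> \bar R) : (forall x, 0 <= a x)%E ->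
    (forall x, a x <= b x)%E -> (\int[mu]_x a x <= \int[mu]_x b x)%E.
  move=> a0 ab; have b0 x : (0 <= b x)%E by exact: le_trans (ab x).
  rewrite !ge0_integralTE//; apply: le_ereal_sup => _ [h ha <-].
  by exists h => // x; exact: le_trans (ha x) (ab x).
move=> fg; rewrite integralE [leRHS]integralE leeB//; apply: ge0_mono => // x.
- by rewrite !funeposE ge_max !le_max fg lexx orbT.
- by rewrite !funenegE ge_max !le_max leeN2 fg lexx orbT.
Qed.

(** * Mixtures, densities and divergence bounds *)

Section Mixture.
Context {R : realType} {dO dT : measure_display} {O : measurableType dO}
  {T : measurableType dT}.
Local Open Scope ereal_scope.

(** Simple functions, then monotone convergence. With weighted point masses for [k o] this yields
    integration against a density and over an independent event; with images of a kernel under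
    pairing it yields disintegration. *)
Lemma integral_mixture (P : {measure set O -> \bar R})
    (m : {measure set T -> \bar R}) (k : O -> {measure set T -> \bar R})
    (f : T -> \bar R) :
  (forall A, measurable A -> measurable_fun setT (k^~ A)) ->
  (forall A, measurable A -> m A = \int[P]_o k o A) ->
  measurable_fun setT f -> (forall x, 0 <= f x) ->
  measurable_fun setT (fun o => \int[k o]_x f x) /\
  \int[m]_x f x = \int[P]_o \int[k o]_x f x.
Proof.
move=> mk mE mf f0.
have simple (h : {nnsfun T >-> R}) :
    measurable_fun setT (fun o => \int[k o]_x (h x)%:E) /\
    \int[m]_x (h x)%:E = \int[P]_o \int[k o]_x (h x)%:E.
  have kE o : \int[k o]_x (h x)%:E =
      \sum_(x \in range h) x%:E * k o (h @^-1` [set x]).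
    by rewrite integralT_nnsfun sintegralE.
  under eq_fun do rewrite kE.
  split.
    apply: emeasurable_fsum => // r; apply: measurable_funeM.
    exact: mk.
  rewrite integralT_nnsfun sintegralE ge0_integral_fsum//.
  - apply: eq_fsbigr => r /[!inE] -[x _ <-].
    by rewrite ge0_integralZl ?lee_fin// -?mE//; exact: mk.
  - by move=> r; apply: measurable_funeM; exact: mk.
  - move=> r o _; have [r0|r0] := leP 0%R r; first by rewrite mule_ge0.
    by rewrite preimage_nnfun0// measure0 mule0.
pose h := nnsfun_approx measurableT mf.
have limE (nu : {measure set T -> \bar R}) :
    \int[nu]_x (h n x)%:E @[n --> \oo] --> \int[nu]_x f x.
  have -> : \int[nu]_x f x = \int[nu]_x limn (fun n => (h n x)%:E).
    apply: eq_integral => x _; apply/esym/cvg_lim => //.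
    exact: cvg_nnsfun_approx.
  apply: cvg_monotone_convergence => //.
  - by move=> n; exact/measurable_EFinP.
  - by move=> n x _; rewrite lee_fin.
  - by move=> x _ a b ab; rewrite lee_fin; exact/lefP/nd_nnsfun_approx.
have mkh n : measurable_fun setT (fun o => \int[k o]_x (h n x)%:E).
  by have [] := simple (h n).
have mkf : measurable_fun setT (fun o => \int[k o]_x f x).
  by apply: (emeasurable_fun_cvg (fun n o => \int[k o]_x (h n x)%:E)).
split => //.
have mhE : (fun n => \int[m]_x (h n x)%:E) =
    (fun n => \int[P]_o \int[k o]_x (h n x)%:E).
  by apply/funext => n; exact: (simple (h n)).2.
have := limE m; rewrite mhE => limm; apply: (cvg_unique _ limm) => //.
have -> : \int[P]_o \int[k o]_x f x =
    \int[P]_o limn (fun n => \int[k o]_x (h n x)%:E).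
  by apply: eq_integral => o _; apply/esym/cvg_lim => //; exact: limE.
apply: cvg_monotone_convergence => //.
- by move=> n o _; apply: integral_ge0 => x _; rewrite lee_fin.
- move=> o _ a b ab; apply: integral_mono => x.
  by rewrite lee_fin; exact/lefP/nd_nnsfun_approx.
Qed.

(** Dynkin's pi-lambda theorem. Measurability and the mixture identity are carried through the
    induction together, because the identity for complements and countable unions integrates
    functions that must already be known to be measurable. *)
Lemma mixture_of_generator (P : probability O R)
    (m : probability T R) (k : O -> probability T R) (G : set (set T)) :
  @measurable _ T = <<s G >> -> setI_closed G ->
  (forall A, G A -> measurable_fun setT (fun o => k o A)) ->
  (forall A, G A -> m A = \int[P]_o k o A) ->
  forall A, measurable A ->
    measurable_fun setT (fun o => k o A) /\ m A = \int[P]_o k o A.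
Proof.
move=> TG GI Gm GE A; rewrite TG.
have mU (nu : probability T R) (F : (set T)^nat) :
    (forall n, measurable (F n)) -> trivIset setT F ->
    nu (\bigcup_n F n) = \sum_(n <oo) nu (F n).
  by move=> mF tF; rewrite measure_bigcup//; apply: eq_eseriesl => n; rewrite in_setT.
have int1 : \int[P]__ (1 : \bar R) = 1.
  by rewrite integral_cst// mul1e; exact: probability_setT.
apply: (dynkin_induction (G := G) (P := fun A =>
  measurable_fun setT (fun o => k o A) /\ m A = \int[P]_o k o A)) => //.
- under eq_fun do rewrite probability_setT.
  by split => //; rewrite int1; exact: probability_setT.
- by move=> B GB; split; [exact: Gm|exact: GE].
- move=> B mB [mkB EB].
  have kC o : k o (~` B) = 1 - k o B by exact: probability_setC.
  under eq_fun do rewrite kC.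
  split; first exact: emeasurable_funB.
  rewrite integralB//.
  + by rewrite int1 -EB; exact: probability_setC.
  + exact: finite_measure_integrable_cst.
  + apply/integrableP; split => //.
    under eq_integral do rewrite gee0_abs//.
    by rewrite -EB ltey_eq fin_num_measure.
- move=> F mF tF H.
  have kU o : k o (\bigcup_n F n) = \sum_(n <oo) k o (F n) by exact: mU.
  under eq_fun do rewrite kU.
  split.
    by apply: ge0_emeasurable_sum => n _ //; exact: (H n).1.
  rewrite integral_nneseries//; last by move=> n; exact: (H n).1.
  rewrite mU//; apply: eq_eseriesr => n _; exact: (H n).2.
Qed.

End Mixture.

Section Density.
Context {R : realType} {d : measure_display} {T : measurableType d}.

Lemma bounded_integrable (P : probability T R) (g : T -> R) (M : R) :
  measurable_fun setT g -> (forall x, `|g x| <= M) ->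
  P.-integrable setT (EFin \o g).
Proof.
move=> mg gM; apply: measurable_bounded_integrable => //.
  by rewrite (le_lt_trans (probability_le1 P measurableT))// ltry.
exists M; split; first exact: num_real.
by move=> y My x _; exact: le_trans (gM x) (ltW My).
Qed.

Lemma ge0_integral_density (P Q : {measure set T -> \bar R}) (h : T -> R)
    (f : T -> \bar R) :
  is_density P Q h -> measurable_fun setT f -> (forall x, 0 <= f x)%E ->
  (\int[P]_x f x = \int[Q]_x ((h x)%:E * f x))%E.
Proof.
move=> [mh h0 hP] mf f0.
(* [P] is the mixture, over [Q], of the point masses at [x] of weight [h x]. *)
pose k x : {measure set T -> \bar R} := mscale (NngNum (h0 x)) (dirac x).
have kE x A : k x A = ((h x)%:E * (\1_A x)%:E)%E by [].
have [||_ ->] := @integral_mixture _ _ _ _ _ Q P k f _ _ mf f0.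
- move=> A mA; under eq_fun do rewrite kE -EFinM.
  by apply/measurable_EFinP; apply: measurable_funM.
- move=> A mA; rewrite hP// integral_mkcond; apply: eq_integral => x _.
  by rewrite kE patchE indicE; case: (x \in A); rewrite ?mule1 ?mule0.
- apply: eq_integral => x _.
  by rewrite ge0_integral_mscale//= integral_dirac// diracT mul1e.
Qed.

Lemma integrable_density (P Q : probability T R) (h g : T -> R) (M : R) :
  is_density P Q h -> measurable_fun setT g -> (forall x, `|g x| <= M) ->
  Q.-integrable setT (EFin \o (h \* g)).
Proof.
move=> Ph mg gM; have [mh h0 hP] := Ph.
apply/integrableP; split.
  by apply/measurable_EFinP; exact: measurable_funM.
have -> : (\int[Q]_x `|(h x * g x)%:E| = \int[P]_x (`|g x|)%:E)%E.
  rewrite (ge0_integral_density Ph)//.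
    by apply: eq_integral => x _; rewrite /= normrM ger0_norm// EFinM.
  by apply/measurable_EFinP; exact: measurableT_comp.
have /integrableP[_] := bounded_integrable P mg gM.
by [].
Qed.

Lemma Rintegral_density (P Q : probability T R) (h g : T -> R) (M : R) :
  is_density P Q h -> measurable_fun setT g -> (forall x, `|g x| <= M) ->
  \int[P]_x g x = \int[Q]_x (h x * g x).
Proof.
move=> Ph mg gM; have [mh h0 hP] := Ph.
have M1 (x : T) : `|cst M x : R| <= `|M| by exact: lexx.
have iP : P.-integrable setT (EFin \o g) by exact: bounded_integrable gM.
have icP : P.-integrable setT (EFin \o cst M) by exact: bounded_integrable M1.
have iQ : Q.-integrable setT (EFin \o (h \* g)) by exact: (integrable_density Ph mg gM).
have icQ : Q.-integrable setT (EFin \o (h \* cst M)) by exact: (integrable_density Ph _ M1).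
have gM0 x : 0 <= g x + M by have := gM x; rewrite ler_norml; lra.
(* Adding the bound [M] makes the test function nonnegative; the constant is cancelled at the
   end. *)
have shift : \int[P]_x (g x + M) = \int[Q]_x (h x * (g x + M)).
  rewrite /Rintegral (ge0_integral_density Ph)//.
  by apply/measurable_EFinP; exact: measurable_funD.
have hM : \int[P]_x (cst M x) = \int[Q]_x (h x * M).
  have E (N : R) : 0 <= N -> \int[P]_x (cst N x) = \int[Q]_x (h x * N).
    by move=> N0; rewrite /Rintegral (ge0_integral_density Ph)//; apply/measurable_EFinP.
  (* A point of [T] gives [0 <= M]; without points both integrals are 0. *)
  have [[x _]|T0] := pselect (exists x : T, True).
    by apply: E; exact: le_trans (gM x).
  by rewrite /Rintegral !integral0_eq// => x; exfalso; apply: T0; exists x.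
apply: (addIr (\int[P]_x cst M x)).
rewrite [in RHS]hM -RintegralD// -RintegralD//.
by rewrite shift; apply: eq_Rintegral => x _; rewrite mulrDr.
Qed.

Lemma Rintegral1 (P : probability T R) : \int[P]_x (1 : R) = 1.
Proof.
by rewrite Rintegral_cst// mul1r -[RHS]/(fine 1%E); congr fine; exact: probability_setT.
Qed.

(** [KL] is computed from a density picked by choice, so the bound is asked of every density. Going
    through an integrable minorant [q] spares any integrability of [h * ln h], and the case without
    density is trivial since [KL] is then infinite. *)
Lemma le_KL (P Q : probability T R) (r : R) :
  (forall h, is_density P Q h -> exists2 q : T -> R,
     (forall x, q x <= h x * ln (h x)) &
     Q.-integrable setT (EFin \o q) /\ r <= \int[Q]_x q x) ->
  (r%:E <= KL P Q)%E.
Proof.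
move=> H; rewrite /KL; case: pselect => [ex|_]; last exact: leey.
case: (cid ex) => h Ph /=.
have [q qh [iq rq]] := H _ Ph.
have : (\int[Q]_x (q x)%:E <= \int[Q]_x (h x * ln (h x))%:E)%E.
  by apply: integral_mono => x; rewrite lee_fin.
apply: le_trans.
rewrite -[leRHS]fineK ?lee_fin//; exact: integrable_fin_num.
Qed.

Lemma pinsker (P Q : probability T R) (g : T -> R) :
  measurable_fun setT g -> (forall x, `|g x| <= 1) ->
  ((`|\int[P]_x g x - \int[Q]_x g x|)%:E <= sqrte (2%:E * KL P Q))%E.
Proof.
move=> mg g1.
set a := _ - _.
suff : ((a ^+ 2 / 2)%:E <= KL P Q)%E.
  rewrite -(@lee_pmul2l _ 2%:E)// -EFinM mulrCA mulfV// mulr1 => a2.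
  have := a2; rewrite -lee_sqrt; last by apply: le_trans a2; rewrite lee_fin sqr_ge0.
  by rewrite EFin_expe sqrte_sqr.
apply: le_KL => h Ph; have [mh h0 _] := Ph.
have m1 : measurable_fun setT (cst 1 : T -> R) by [].
have c1 (x : T) : `|cst 1 x : R| <= 1 by rewrite normr1.
have i1 : Q.-integrable setT (EFin \o cst 1) by exact: bounded_integrable c1.
have ih1 : Q.-integrable setT (EFin \o (h \* cst 1)).
  exact: (integrable_density Ph m1 c1).
have ih : Q.-integrable setT (EFin \o h).
  by rewrite (_ : h = h \* cst 1)//; apply/funext => x /=; rewrite mulr1.
have ihg : Q.-integrable setT (EFin \o (h \* g)).
  exact: (integrable_density Ph mg g1).
have ig : Q.-integrable setT (EFin \o g) by exact: bounded_integrable g1.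
(* The bound [xlnx_ge_quadratic] at [c = l * g x], with [(g x)^2 <= 1], integrates to
   [2 * l * a - 2 * l^2]; the choice [l = a / 2] maximises this, with value [a^2 / 2]. The
   coefficients 2/3 and 4/3 split the weight [h + 2]. *)
exists (fun x => ((1 - 2/3 * (a/2)^+2) * h x + a * (h x * g x)) -
   (a * g x + (1 + 4/3 * (a/2)^+2) * 1)) => [x|].
  apply: le_trans (xlnx_ge_quadratic (a / 2 * g x) (h0 x)).
  have g2 : g x ^+ 2 <= 1.
    by rewrite -real_normK ?num_real// expr_le1.
  have : 0 <= (a / 2)^+2 * (h x + 2) * (1 - g x ^+ 2).
    by rewrite mulr_ge0 ?subr_ge0// mulr_ge0 ?sqr_ge0// addr_ge0.
  rewrite !expr2; lra.
have iZ c (u : T -> R) : Q.-integrable setT (EFin \o u) ->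
    Q.-integrable setT (EFin \o (fun x => c * u x)).
  by move=> iu; exact: (integrableZl measurableT c iu).
have iD (u v : T -> R) : Q.-integrable setT (EFin \o u) ->
    Q.-integrable setT (EFin \o v) ->
    Q.-integrable setT (EFin \o (fun x => u x + v x)).
  by move=> iu iv; exact: (integrableD measurableT iu iv).
have ip := iD _ _ (iZ (1 - 2/3 * (a/2)^+2) _ ih) (iZ a _ ihg).
have im := iD _ _ (iZ a _ ig) (iZ (1 + 4/3 * (a/2)^+2) _ i1).
split; first exact: (integrableB measurableT ip im).
rewrite RintegralB// !RintegralD//; try exact: iZ.
rewrite !RintegralZl// Rintegral1 -(Rintegral_density Ph mg g1).
have -> : \int[Q]_x h x = 1.
  rewrite -(Rintegral1 P) (Rintegral_density Ph m1 c1).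
  by apply: eq_Rintegral => x _; rewrite mulr1.
have : a * a = a * \int[P]_x g x - a * \int[Q]_x g x by rewrite -mulrBr.
rewrite !expr2 !mulr1; lra.
Qed.

(** Integrated form of [xlnx_ge_affine]. Compared with the Donsker-Varadhan formula, [1 - int g dQ]
    replaces [- ln (int g dQ)]: weaker for a given [g], but affine in [Q], so that it can be
    averaged over a family of pairs of measures. *)
Lemma KL_ge_variational (P Q : probability T R) (g : T -> R) (e M : R) :
  0 < e -> measurable_fun setT g -> (forall x, e <= g x <= M) ->
  ((\int[P]_x ln (g x) + 1 - \int[Q]_x g x)%:E <= KL P Q)%E.
Proof.
move=> e0 mg geM.
have g0 x : 0 < g x by have /andP[] := geM x => /(lt_le_trans e0).
have mlg : measurable_fun setT (fun x => ln (g x)) by exact: measurableT_comp.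
have lgb x : `|ln (g x)| <= `|ln e| + `|ln M|.
  have /andP[eg gM] := geM x.
  have l1 : ln e <= ln (g x) by rewrite ler_ln ?posrE.
  have l2 : ln (g x) <= ln M by rewrite ler_ln ?posrE// (lt_le_trans (g0 x)).
  have := ler_norm (ln M); have := ler_norm (- ln e); rewrite normrN.
  have := normr_ge0 (ln M); have := normr_ge0 (ln e).
  by rewrite ler_norml; lra.
have gb x : `|g x| <= M by have /andP[_] := geM x; rewrite gtr0_norm.
apply: le_KL => h Ph; have [mh h0 _] := Ph.
have m1 : measurable_fun setT (cst 1 : T -> R) by [].
have c1 (x : T) : `|cst 1 x : R| <= 1 by rewrite normr1.
have ih1 : Q.-integrable setT (EFin \o (h \* cst 1)).
  exact: (integrable_density Ph m1 c1).
have ih : Q.-integrable setT (EFin \o h).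
  by rewrite (_ : h = h \* cst 1)//; apply/funext => x /=; rewrite mulr1.
have ihg : Q.-integrable setT (EFin \o (h \* (fun x => ln (g x)))).
  exact: (integrable_density Ph mlg lgb).
have ig : Q.-integrable setT (EFin \o g) by exact: bounded_integrable gb.
exists (fun x => (h x * ln (g x) + h x) - g x) => [x|].
  exact: xlnx_ge_affine.
have ihh : Q.-integrable setT (EFin \o (fun x => h x * ln (g x) + h x)).
  exact: (integrableD measurableT ihg ih).
split; first exact: (integrableB measurableT ihh ig).
rewrite RintegralB// RintegralD// -(Rintegral_density Ph mlg lgb).
have -> : \int[Q]_x h x = 1.
  rewrite -(Rintegral1 P) (Rintegral_density Ph m1 c1).
  by apply: eq_Rintegral => x _; rewrite mulr1.
by [].
Qed.

Lemma KL_ge0 (P Q : probability T R) : (0 <= KL P Q)%E.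
Proof.
have m1 : measurable_fun setT (cst 1 : T -> R) by [].
have := @KL_ge_variational P Q (cst 1) 1 1 ltr01 m1 (fun=> _).
rewrite /= ln1 Rintegral1 Rintegral_cst// mul0r add0r subrr; apply => //.
by move=> x; rewrite lexx.
Qed.

End Density.

(** * Laws, pi-systems and independence *)

(** [MI] and [CMI] are written with bare pushforwards. This is the same set function equipped with
    its probability structure, so that they are, by conversion, divergences between
    probabilities. *)
Definition law (R : realType) dO dT (O : measurableType dO)
    (T : measurableType dT) (P : probability O R) (X : O -> T)
    (mX : measurable_fun setT X) : probability T R :=
  let X' : {mfun O >-> T} := HB.pack X (isMeasurableFun.Build _ _ _ _ X mX) in
  distribution P X'.

Lemma lawE (R : realType) dO dT (O : measurableType dO)
    (T : measurableType dT) (P : probability O R) (X : O -> T)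
    (mX : measurable_fun setT X) :
  law P mX = pushforward P X :> (set T -> \bar R).
Proof. by []. Qed.

Lemma ge0_integral_law (R : realType) dO dT (O : measurableType dO)
    (T : measurableType dT) (P : probability O R) (X : O -> T)
    (mX : measurable_fun setT X) (f : T -> \bar R) :
  measurable_fun setT f -> (forall x, 0 <= f x)%E ->
  (\int[law P mX]_x f x = \int[P]_o f (X o))%E.
Proof. by move=> mf f0; rewrite ge0_integral_pushforward. Qed.

Definition image_measure (R : realType) dO dT (O : measurableType dO)
    (T : measurableType dT) (m : {measure set O -> \bar R}) (X : O -> T)
    (mX : measurable_fun setT X) : {measure set T -> \bar R} :=
  measure_function_pushforward__canonical__measure_function_Measure m mX.

Section Generators.
Context {dT : measure_display} {T : measurableType dT}.

(** [G setT] provides the covering sequence for uniqueness of finite measures and the free sides of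
    boxes. *)
Definition pi_generator (G : set (set T)) :=
  [/\ @measurable _ T = <<s G >>, setI_closed G & G setT].

Definition boxes (n : nat) (G : set (set T)) : set (set (n.-tuple T)) :=
  [set [set t | forall i, B i (tnth t i)] | B in [set B | forall i : 'I_n, G (B i)]].

Lemma measurable_box (n : nat) (B : 'I_n -> set T) :
  (forall i, measurable (B i)) -> measurable [set t | forall i, B i (tnth t i)].
Proof.
move=> mB.
have -> : [set t | forall i, B i (tnth t i)] =
    \bigcap_(i in [set: 'I_n]) ((@tnth _ T ^~ i) @^-1` B i).
  by apply/seteqP; split=> [t H i _|t H i]; exact: H.
apply: fin_bigcap_measurable => // i _.
by rewrite -[X in measurable X]setTI; exact: measurable_tnth.
Qed.

Lemma pi_generator_measurable : pi_generator (@measurable _ T).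
Proof.
split; [|exact: measurableI|exact: measurableT].
by rewrite sigma_algebra_id//; exact: sigma_algebra_measurable.
Qed.

End Generators.

Arguments boxes {dT T} n G.

(** That boxes generate enough amounts to measurability of the identity out of the space carrying
    the generated sigma-algebra. This is checked coordinate by coordinate, where the preimage is a
    box with a single constrained side. *)
Lemma pi_generator_boxes dT (T : measurableType dT) (n : nat) (G : set (set T)) :
  pi_generator G -> pi_generator (boxes n G).
Proof.
move=> [TG GI GT]; split.
- apply/seteqP; split; last first.
    apply: smallest_sub; first exact: sigma_algebra_measurable.
    move=> _ [B GB <-]; apply: measurable_box => i; rewrite TG.
    exact: sub_sigma_algebra.
  move=> A mA.
  pose T' := g_sigma_algebraType (boxes n G).
  have : measurable_fun [set: T'] (id : T' -> n.-tuple T).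
    apply/measurable_fun_tnthP => i.
    apply: (measurability _ TG) => _ [B GB <-].
    apply: sub_sigma_algebra; exists (fun j => if j == i then B else setT).
      by move=> j /=; case: ifP.
    rewrite setTI; apply/seteqP; split=> [t /(_ i)|t /= Bt j]; first by rewrite eqxx.
    by case: eqP => [->|].
  by move=> /(_ measurableT _ mA); rewrite setTI.
- move=> _ _ [B GB <-] [C GC <-]; exists (fun i => B i `&` C i).
    by move=> i; exact: GI.
  apply/seteqP; split=> [t H|t [H1 H2] i]; last by split.
  by split => i; have [] := H i.
- by exists (fun=> setT) => //; apply/seteqP; split.
Qed.

Lemma pi_generator_rectangles d1 d2 (T1 : measurableType d1)
    (T2 : measurableType d2) :
  pi_generator
    [set A `*` B | A in @measurable _ T1 & B in @measurable _ T2].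
Proof.
split; first exact: measurable_prod_measurableType.
- move=> _ _ [A mA [B mB <-]] [C mC [D mD <-]].
  exists (A `&` C); first exact: measurableI.
  exists (B `&` D); first exact: measurableI.
  by rewrite setXI.
- by exists setT => //; exists setT => //; rewrite setXTT.
Qed.

Section Uniqueness.
Context {R : realType} {dO dT : measure_display} {O : measurableType dO}
  {T : measurableType dT} (P : probability O R).
Local Open Scope ereal_scope.

Lemma measure_eq_generator (G : set (set T)) (m1 m2 : {measure set T -> \bar R}) :
  pi_generator G -> m1 setT < +oo -> (forall A, G A -> m1 A = m2 A) ->
  forall A, measurable A -> m1 A = m2 A.
Proof.
move=> [TG GI GT] m1oo m12 A mA.
apply: (measure_unique G (fun=> setT)) => //.
by rewrite bigcup_const//; exists 0%N.
Qed.

Variables (X : O -> T) (mX : measurable_fun setT X).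
Variables (E : set O) (mE : measurable E).

(** Both sides are finite measures in [A], hence determined by a pi-system. *)
Lemma indep_of_generator (G : set (set T)) : pi_generator G ->
  (forall A, G A -> P (X @^-1` A `&` E) = P (X @^-1` A) * P E) ->
  forall A, measurable A -> P (X @^-1` A `&` E) = P (X @^-1` A) * P E.
Proof.
move=> genG GE A mA.
have PE0 : (0 <= fine (P E))%R by exact: fine_ge0.
have PEE : (fine (P E))%:E = P E by rewrite fineK// fin_num_measure.
pose PE : {nonneg R} := NngNum PE0.
pose m1 : {measure set T -> \bar R} := image_measure (mrestr P mE) mX.
pose m2 : {measure set T -> \bar R} := mscale PE (image_measure P mX).
have m1E B : m1 B = P (X @^-1` B `&` E) by [].
have m2E B : m2 B = P (X @^-1` B) * P E.
  by rewrite muleC -PEE.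
rewrite -m1E -m2E; apply: (measure_eq_generator genG) => //.
- rewrite m1E (le_lt_trans (probability_le1 P _)) ?ltry//.
  by rewrite preimage_setT setTI.
- by move=> B GB; rewrite m1E m2E GE.
Qed.

(** By independence, [P E] times the law of [X] is the mixture over [o] of the point masses at [X o]
    of weight [\1_E o]. *)
Lemma ge0_integral_indep (f : T -> \bar R) :
  (forall A, measurable A -> P (X @^-1` A `&` E) = P (X @^-1` A) * P E) ->
  measurable_fun setT f -> (forall x, 0 <= f x) ->
  \int[P]_(o in E) f (X o) = P E * \int[P]_o f (X o).
Proof.
move=> XE mf f0.
have PE0 : (0 <= fine (P E))%R by exact: fine_ge0.
have PEE : (fine (P E))%:E = P E by rewrite fineK// fin_num_measure.
pose m : {measure set T -> \bar R} := mscale (NngNum PE0) (image_measure P mX).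
have i0 o : (0 <= (\1_E o : R))%R by [].
pose k o : {measure set T -> \bar R} := mscale (NngNum (i0 o)) (dirac (X o)).
have kE o A : k o A = (\1_E o)%:E * (\1_A (X o))%:E by [].
have mi (A : set O) : measurable A -> measurable_fun setT (\1_A : O -> R) by [].
have [||_] := @integral_mixture _ _ _ _ _ P m k f _ _ mf f0.
- move=> A mA; under eq_fun do rewrite kE -EFinM.
  apply/measurable_EFinP; apply: measurable_funM => //.
  by apply: measurableT_comp.
- move=> A mA.
  have mXA : measurable (X @^-1` A) by rewrite -[X in measurable X]setTI; exact: mX.
  have -> : m A = P (X @^-1` A) * P E by rewrite muleC -PEE.
  rewrite -XE// -[LHS]mul1e -integral_cst//; last exact: measurableI.
  rewrite integral_mkcond; apply: eq_integral => o _.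
  rewrite kE patchE in_setI !indicE.
  have -> : (X o \in A) = (o \in X @^-1` A).
    by apply/idP/idP => /set_mem ?; exact/mem_set.
  by case: (o \in X @^-1` A); case: (o \in E); rewrite ?mule1 ?mule0.
- rewrite ge0_integral_mscale//= PEE.
  have -> : \int[image_measure P mX]_x f x = \int[P]_o f (X o).
    by rewrite ge0_integral_pushforward.
  move=> ->; rewrite integral_mkcond; apply: eq_integral => o _.
  rewrite patchE ge0_integral_mscale//= integral_dirac// diracT mul1e indicE.
  by case: (o \in E); rewrite ?mul1e ?mul0e.
Qed.

End Uniqueness.

Lemma preimage_measurable d1 d2 (T1 : measurableType d1) (T2 : measurableType d2)
    (f : T1 -> T2) (A : set T2) :
  measurable_fun setT f -> measurable A -> measurable (f @^-1` A).
Proof. by move=> mf mA; rewrite -[X in measurable X]setTI; exact: mf. Qed.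

Lemma measurable_bool_tuple n (u : n.-tuple bool) : measurable [set u].
Proof.
have -> : [set u] = [set t | forall i, [set tnth u i] (tnth t i)].
  by apply/seteqP; split=> [t -> //|t /= H]; apply: eq_from_tnth.
exact: (@measurable_box _ bool n (fun i => [set tnth u i])).
Qed.

Lemma preimage_pair S T1 T2 (f : S -> T1) (g : S -> T2) A B :
  (fun o => (f o, g o)) @^-1` (A `*` B) = f @^-1` A `&` g @^-1` B.
Proof. by apply/seteqP; split. Qed.

(** * The supersample model *)

Section SupersampleLaws.
Context {R : realType} {dO dX dY dW : measure_display}
  {O : measurableType dO} {X : measurableType dX} {Y : measurableType dY}
  {Wt : measurableType dW} {n : nat} (P : probability O R)
  (mu : probability (X * Y)%type R)
  (Alg : R.-pker (n.-tuple (X * Y)%type) ~> Wt)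
  (Zt : O -> n.-tuple ((X * Y) * (X * Y))) (U : O -> n.-tuple bool)
  (W : O -> Wt).
Hypotheses (mZt : measurable_fun setT Zt) (mU : measurable_fun setT U)
  (mW : measurable_fun setT W) (model : supersample_model P mu Alg Zt U W).
Local Open Scope ereal_scope.

Definition zproj (i : 'I_n) (b : bool) (z : n.-tuple ((X * Y) * (X * Y))) :=
  if b then (tnth z i).2 else (tnth z i).1.

Lemma measurable_zproj i b : measurable_fun setT (zproj i b).
Proof.
rewrite /zproj; case: b.
- by apply: (measurableT_comp measurable_snd); exact: measurable_tnth.
- by apply: (measurableT_comp measurable_fst); exact: measurable_tnth.
Qed.

Lemma tnth_select (z : n.-tuple ((X * Y) * (X * Y))) u i :
  tnth (select_sample z u) i = zproj i (tnth u i) z.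
Proof. by rewrite tnth_mktuple. Qed.

Lemma measurable_tnthU i : measurable_fun setT (fun o => tnth (U o) i).
Proof. exact: (measurableT_comp (measurable_tnth i) mU). Qed.

Lemma measurable_select : measurable_fun setT
  (fun zu : n.-tuple ((X * Y) * (X * Y)) * n.-tuple bool =>
    select_sample zu.1 zu.2).
Proof.
apply/measurable_fun_tnthP => i.
have -> : (@tnth n (X * Y)%type ^~ i) \o (fun zu : n.-tuple ((X * Y) * (X * Y)) * n.-tuple bool =>
    select_sample zu.1 zu.2) = (fun zu => if tnth zu.2 i then zproj i true zu.1 else zproj i false zu.1).
  by apply/funext => zu /=; rewrite tnth_select; case: (tnth _ _).
apply: measurable_fun_ifT.
- exact: (measurableT_comp (measurable_tnth i) measurable_snd).
- exact: (measurableT_comp (measurable_zproj i _) measurable_fst).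
- exact: (measurableT_comp (measurable_zproj i _) measurable_fst).
Qed.

(* The member of the [i]-th pair left out of the training sample. *)
Definition ghost_point i o := zproj i (~~ tnth (U o) i) (Zt o).
Definition train_sample o := select_sample (Zt o) (U o).

Lemma measurable_sample : measurable_fun setT train_sample.
Proof.
exact: (measurableT_comp measurable_select (measurable_fun_pair mZt mU)).
Qed.

Definition ghost_of i (zu : n.-tuple ((X * Y) * (X * Y)) * n.-tuple bool) :=
  zproj i (~~ tnth zu.2 i) zu.1.

Lemma measurable_ghost_of i : measurable_fun setT (ghost_of i).
Proof.
have -> : ghost_of i = (fun zu => if tnth zu.2 i then zproj i false zu.1 else zproj i true zu.1).
  by apply/funext => zu; rewrite /ghost_of; case: (tnth _ _).
apply: measurable_fun_ifT.
- exact: (measurableT_comp (measurable_tnth i) measurable_snd).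
- exact: (measurableT_comp (measurable_zproj i _) measurable_fst).
- exact: (measurableT_comp (measurable_zproj i _) measurable_fst).
Qed.

Lemma measurable_ghost i : measurable_fun setT (ghost_point i).
Proof.
exact: (measurableT_comp (measurable_ghost_of i) (measurable_fun_pair mZt mU)).
Qed.

(** Mutual independence over the index set of the model, with the three indices of each [i] (two
    points and one selector bit) regrouped. The later independence statements about [Zt] and [U] are
    extended from this product formula through pi-systems. *)
Lemma box_probability (A : 'I_n -> bool -> set (X * Y)) (B : 'I_n -> set bool) :
  (forall i b, measurable (A i b)) ->
  P [set o | forall i, [/\ A i false (zproj i false (Zt o)),
      A i true (zproj i true (Zt o)) & B i (tnth (U o) i)]] =
  \prod_(i < n) (mu (A i false) * mu (A i true) *
    P ((fun o => tnth (U o) i) @^-1` B i)).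
Proof.
move=> mA; have [indep zlaw _ _] := model.
pose E (k : 'I_n * option bool) : set O :=
  if k.2 is Some b then zcomp Zt k.1 b @^-1` A k.1 b
  else (fun o => tnth (U o) k.1) @^-1` B k.1.
have := indep [set: 'I_n * option bool]%SET E.
rewrite (eq_bigl xpredT) => [|k]; last exact: finset.in_setT.
rewrite [X in (_ -> _ = X) -> _](eq_bigl xpredT) => [|k]; last exact: finset.in_setT.
have -> : \big[setI/setT]_(k : 'I_n * option bool) E k =
  [set o | forall i, [/\ A i false (zproj i false (Zt o)),
      A i true (zproj i true (Zt o)) & B i (tnth (U o) i)]].
  rewrite -bigcap_seq; apply/seteqP; split=> [ o H i|o H k _]; last case: k => i [b|] /=.
  - split; [exact: (H (i, Some false) (mem_index_enum _))|
            exact: (H (i, Some true) (mem_index_enum _))|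
            exact: (H (i, None) (mem_index_enum _))].
  - by have [] := H i; case: b.
  - by have [] := H i.
move=> ->; last first.
  move=> [i [b|]] _ /=; last by exists (B i).
  by exists (A i b).
rewrite -(pair_bigA _ (fun i j => P (E (i, j)))) /=; apply: eq_bigr => i _.
rewrite (bigD1 None)//= (bigD1 (Some true))//= (bigD1 (Some false))//=.
rewrite big1 ?mule1 => [|[[]|]]//.
by rewrite /E /= !zlaw// muleC [mu _ * mu _]muleC.
Qed.

Lemma supersample_indep_U (u : n.-tuple bool) C : measurable C ->
  P (Zt @^-1` C `&` U @^-1` [set u]) = P (Zt @^-1` C) * P (U @^-1` [set u]).
Proof.
have mu1 := measurable_bool_tuple u.
have genZ := pi_generator_boxes n
  (pi_generator_rectangles (X * Y)%type (X * Y)%type).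
apply: (indep_of_generator mZt (preimage_measurable mU mu1) genZ) => _ [B recB <-].
have /choice[A AB] : forall i, exists A : set (X * Y) * set (X * Y),
    [/\ measurable A.1, measurable A.2 & B i = A.1 `*` A.2].
  by move=> i; have [A1 mA1 [A2 mA2 <-]] := recB i; exists (A1, A2).
pose A' i (b : bool) := if b then (A i).2 else (A i).1.
have mA' i b : measurable (A' i b) by have [] := AB i; case: b.
have BE i z : B i (tnth z i) = (A' i false (zproj i false z) /\ A' i true (zproj i true z)).
  by have [_ _ ->] := AB i.
have -> : Zt @^-1` [set t | forall i, B i (tnth t i)] `&` U @^-1` [set u] =
  [set o | forall i, [/\ A' i false (zproj i false (Zt o)),
      A' i true (zproj i true (Zt o)) & [set tnth u i] (tnth (U o) i)]].
  apply/seteqP; split=> [ o [/= H <-] i|o H].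
    by have := H i; rewrite BE => -[].
  split=> [i|]; first by rewrite BE; have [] := H i.
  by apply: eq_from_tnth => i; have [] := H i.
have -> : Zt @^-1` [set t | forall i, B i (tnth t i)] =
  [set o | forall i, [/\ A' i false (zproj i false (Zt o)),
      A' i true (zproj i true (Zt o)) & setT (tnth (U o) i)]].
  apply/seteqP; split=> [ o /= H i|o H i].
    by have := H i; rewrite BE => -[].
  by rewrite BE; have [] := H i.
have -> : U @^-1` [set u] =
  [set o | forall i, [/\ setT (zproj i false (Zt o)),
      setT (zproj i true (Zt o)) & [set tnth u i] (tnth (U o) i)]].
  apply/seteqP; split=> [ o <- i//|o H].
  by apply: eq_from_tnth => i; have [] := H i.
rewrite (box_probability (fun i => [set tnth u i]) mA').
rewrite (box_probability (fun=> setT) mA').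
rewrite (@box_probability (fun _ _ => setT) (fun i => [set tnth u i]))//.
rewrite -big_split/=; apply: eq_bigr => i _.
rewrite preimage_setT.
have -> : P setT = 1 by exact: probability_setT.
have -> : mu setT = 1 by exact: probability_setT.
by rewrite mule1 !mul1e.
Qed.

(** For a fixed selector [u], the training points and the left-out point of pair [i] are distinct
    entries of the supersample; [A'] constrains exactly these and leaves the other entries free. *)
Lemma subsample_box (u : n.-tuple bool) (C : 'I_n -> set (X * Y)) i A :
  (forall k, measurable (C k)) -> measurable A ->
  P ((fun o => select_sample (Zt o) u) @^-1` [set t | forall k, C k (tnth t k)] `&`
     (fun o => zproj i (~~ tnth u i) (Zt o)) @^-1` A) =
  \prod_(k < n) mu (C k) * mu A.
Proof.
move=> mC mA.
pose A' k b := if b == tnth u k then C k else if k == i then A else setT.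
have mA' k b : measurable (A' k b) by rewrite /A'; case: ifP => // _; case: ifP.
have -> : (fun o => select_sample (Zt o) u) @^-1` [set t | forall k, C k (tnth t k)] `&`
     (fun o => zproj i (~~ tnth u i) (Zt o)) @^-1` A =
  [set o | forall k, [/\ A' k false (zproj k false (Zt o)),
      A' k true (zproj k true (Zt o)) & setT (tnth (U o) k)]].
  apply/seteqP; split=> [ o [/= H HA] k|o H].
    have := H k; rewrite tnth_select /A'; case: (eqVneq k i) => [ki|_].
      by move: HA; rewrite -{}ki; case: (tnth u k).
    by case: (tnth u k).
  split=> [k|/=]; first by rewrite tnth_select; have [] := H k; rewrite /A'; case: (tnth u k).
  by have [] := H i; rewrite /A' eqxx; case: (tnth u i).
rewrite (box_probability (fun=> setT) mA').
transitivity (\prod_(k < n) (mu (C k) * mu (if k == i then A else setT))).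
  apply: eq_bigr => k _; rewrite preimage_setT.
  have -> : P setT = 1 by exact: probability_setT.
  by rewrite mule1 /A'; case: (tnth u k) => //=; rewrite muleC.
rewrite big_split/=; congr (_ * _).
rewrite (bigD1 i)//= eqxx big1 ?mule1// => k /negbTE ->.
exact: probability_setT.
Qed.

Lemma ghost_law (u : n.-tuple bool) i A : measurable A ->
  P ((fun o => zproj i (~~ tnth u i) (Zt o)) @^-1` A) = mu A.
Proof. by move=> mA; have [_ zlaw _ _] := model; exact: (zlaw i (~~ tnth u i)). Qed.

Lemma measurable_subsample (u : n.-tuple bool) :
  measurable_fun setT (fun o => select_sample (Zt o) u).
Proof.
exact: (measurableT_comp measurable_select
  (measurable_fun_pair mZt (measurable_cst u))).
Qed.

Lemma subsample_indep (u : n.-tuple bool) i C A :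
  measurable C -> measurable A ->
  P ((fun o => select_sample (Zt o) u) @^-1` C `&`
     (fun o => zproj i (~~ tnth u i) (Zt o)) @^-1` A) =
  P ((fun o => select_sample (Zt o) u) @^-1` C) * mu A.
Proof.
move=> mC mA; rewrite -(ghost_law u i mA).
have mE := preimage_measurable (measurableT_comp (measurable_zproj i (~~ tnth u i)) mZt) mA.
have gen := pi_generator_boxes n (@pi_generator_measurable _ (X * Y)%type).
apply: (indep_of_generator (measurable_subsample u) mE gen) => // _ [B mB <-].
rewrite subsample_box// ghost_law//.
have := @subsample_box u B i setT mB measurableT.
rewrite preimage_setT setIT => ->; congr (_ * _).
by rewrite [X in _ * X](probability_setT mu) mule1.
Qed.

Lemma subsample_law (u v : n.-tuple bool) C : measurable C -> (0 < n)%N ->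
  P ((fun o => select_sample (Zt o) u) @^-1` C) =
  P ((fun o => select_sample (Zt o) v) @^-1` C).
Proof.
(* The index [i] instantiates [subsample_box], with the full set as the event on the left-out
   point. *)
move=> mC n0; pose i := Ordinal n0.
have gen := pi_generator_boxes n (@pi_generator_measurable _ (X * Y)%type).
apply: (measure_eq_generator (m1 := image_measure P (measurable_subsample u))
  (m2 := image_measure P (measurable_subsample v)) gen) => //.
  by rewrite [ltLHS](_ : _ = P setT)// -ge0_fin_numE// fin_num_measure.
move=> _ [B mB <-].
have E w : image_measure P (measurable_subsample w) [set t | forall i, B i (tnth t i)] =
    \prod_(k < n) mu (B k) * mu setT.
  by rewrite -(subsample_box w i)// preimage_setT setIT.
by rewrite !E.
Qed.

Lemma sum_over_U D : measurable D ->
  P D = \sum_(u \in [set: n.-tuple bool]) P (D `&` U @^-1` [set u]).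
Proof.
move=> mD; have mDu u : measurable (D `&` U @^-1` [set u]).
  by apply: measurableI => //; apply: (preimage_measurable mU);
    exact: measurable_bool_tuple.
rewrite -(@measure_fin_bigcup _ _ _ _ _ [set: n.-tuple bool]
  (fun u => D `&` U @^-1` [set u]) finite_finset)//.
- by congr (P _); apply/seteqP; split=> [ o Do|o [u _ []]//]; exists (U o).
- by move=> u v _ _ [ o [[_ <-] [_ <-]]].
Qed.

End SupersampleLaws.

(** * Joint law of the hypothesis, the training sample, the left-out point and the selector *)

Section SupersampleJointLaw.
Context {R : realType} {dO dX dY dW : measure_display}
  {O : measurableType dO} {X : measurableType dX} {Y : measurableType dY}
  {Wt : measurableType dW} {n : nat} (P : probability O R)
  (mu : probability (X * Y)%type R)
  (Alg : R.-pker (n.-tuple (X * Y)%type) ~> Wt)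
  (Zt : O -> n.-tuple ((X * Y) * (X * Y))) (U : O -> n.-tuple bool)
  (W : O -> Wt).
Hypotheses (mZt : measurable_fun setT Zt) (mU : measurable_fun setT U)
  (mW : measurable_fun setT W) (model : supersample_model P mu Alg Zt U W).
Local Open Scope ereal_scope.

Local Notation sample := (train_sample Zt U).
Local Notation ghost := (ghost_point Zt U).
Local Notation Uev i b := ((fun o => tnth (U o) i) @^-1` [set b]).
Local Notation mS := (measurable_sample mZt mU).
Local Notation mG i := (measurable_ghost mZt mU i).

Lemma measurable_Uev i b : measurable (Uev i b).
Proof. exact: preimage_measurable (measurable_tnthU mU i) _. Qed.

Lemma Uev_probability i b : P (Uev i b) = (2^-1)%:E.
Proof.
have [_ _ Ulaw _] := model.
case: b; first exact: Ulaw.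
have -> : Uev i false = ~` Uev i true.
  by apply/seteqP; split => o /=; case: (tnth _ _).
rewrite (probability_setC P (measurable_Uev i true)) Ulaw -EFinB; congr EFin.
lra.
Qed.

(** Reference selector: by [subsample_law] every selector yields the same sample law, so this one
    names that law until it is identified with the law of [sample]. *)
Let v : n.-tuple bool := [tuple false | _ < n].

(** Split according to the whole selector [U = u]. The supersample is independent of that event, and
    for fixed [u] the probability factors into a value that does not depend on [u]; only the [u]
    whose bit [i] equals [b] contribute. *)
Lemma sample_ghost_U_aux i b C A : measurable C -> measurable A ->
  P (sample @^-1` C `&` ghost i @^-1` A `&` Uev i b) =
  P ((fun o => select_sample (Zt o) v) @^-1` C) * mu A * (2^-1)%:E.
Proof.
move=> mC mA.
have mUb := measurable_Uev i b.
have mE : measurable (sample @^-1` C `&` ghost i @^-1` A `&` Uev i b).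
  apply: measurableI => //; apply: measurableI.
    exact: (preimage_measurable mS).
  exact: (preimage_measurable (mG i)).
rewrite (sum_over_U P mU mE) -(Uev_probability i b) (sum_over_U P mU mUb).
rewrite ge0_mule_fsumr//; apply: eq_fsbigr => u _.
have [ub|ub] := eqVneq (tnth u i) b; last first.
  have -> : Uev i b `&` U @^-1` [set u] = set0.
    by apply/seteqP; split=> // o [/= ob uo]; move: ub; rewrite -uo ob eqxx.
  rewrite measure0 mule0 (_ : _ `&` _ = set0) ?measure0//.
  by apply/seteqP; split=> // o [[_ /= ob] uo]; move: ub; rewrite -uo ob eqxx.
have -> : Uev i b `&` U @^-1` [set u] = U @^-1` [set u].
  by apply/seteqP; split=> [ o []//|o uo]; split=> //=; rewrite -ub -uo.
pose D := (fun z => select_sample z u) @^-1` C `&` zproj i (~~ tnth u i) @^-1` A.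
have mD : measurable D.
  apply: measurableI.
  - apply: preimage_measurable mC.
    exact: (measurableT_comp measurable_select
      (measurable_fun_pair (@measurable_id _ (n.-tuple ((X * Y) * (X * Y))%type) setT)
      (measurable_cst u))).
  - exact: (preimage_measurable (measurable_zproj i _) mA).
have -> : sample @^-1` C `&` ghost i @^-1` A `&` Uev i b `&` U @^-1` [set u] =
    Zt @^-1` D `&` U @^-1` [set u].
  apply/seteqP; split=> [ o [[[H1 H2] H3] /= H4]|o [[H1 H2] /= H4]].
    by move: H1 H2; rewrite /preimage/= /train_sample /ghost_point H4.
  by move: H1 H2; rewrite /preimage/= /train_sample /ghost_point H4.
rewrite (supersample_indep_U mZt mU model) //; congr (_ * _).
have n0 : (0 < n)%N by exact: (leq_ltn_trans (leq0n i) (ltn_ord i)).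
rewrite -(subsample_law mZt model u v mC n0).
exact: (subsample_indep mZt model).
Qed.

Lemma sample_ghost_aux i C A : measurable C -> measurable A ->
  P (sample @^-1` C `&` ghost i @^-1` A) =
  P ((fun o => select_sample (Zt o) v) @^-1` C) * mu A.
Proof.
move=> mC mA.
have mE : measurable (sample @^-1` C `&` ghost i @^-1` A).
  apply: measurableI; first exact: (preimage_measurable mS).
  exact: (preimage_measurable (mG i)).
have -> : sample @^-1` C `&` ghost i @^-1` A =
   (sample @^-1` C `&` ghost i @^-1` A `&` Uev i true) `|`
   (sample @^-1` C `&` ghost i @^-1` A `&` Uev i false).
  rewrite -setIUr (_ : _ `|` _ = setT) ?setIT//.
  by apply/seteqP; split=> // o _; case E: (tnth (U o) i); [left|right].
have PU (D E : set O) : measurable D -> measurable E -> D `&` E = set0 ->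
    P (D `|` E) = P D + P E by move=> *; exact: measureU.
rewrite PU.
- rewrite (sample_ghost_U_aux i true mC mA) (sample_ghost_U_aux i false mC mA).
  rewrite -ge0_muleDr// -EFinD (_ : 2^-1 + 2^-1 = 1)%R ?mule1//; lra.
- by apply: measurableI => //; exact: measurable_Uev.
- by apply: measurableI => //; exact: measurable_Uev.
- by apply/seteqP; split=> // o [[_ /= ->] [_ /=]].
Qed.

Lemma sample_ghost_U i b C A : measurable C -> measurable A ->
  P (sample @^-1` C `&` ghost i @^-1` A `&` Uev i b) =
  P (sample @^-1` C) * mu A * (2^-1)%:E.
Proof.
move=> mC mA; rewrite sample_ghost_U_aux//; congr (_ * _ * _).
(* With the full set as the event on the left-out point, this identifies the reference law with the
   law of [sample]. *)
have := sample_ghost_aux i mC measurableT.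
rewrite preimage_setT setIT => ->.
by rewrite [X in _ = _ * X](probability_setT mu) mule1.
Qed.

(** The algorithm sees the supersample and the selector only through the sample: the conditional
    probability of [W] in [B] is a function of [sample], which is independent of the event on the
    left-out point and the selector bit. Integrating that function over the event therefore
    factors. *)
Lemma W_sample_ghost_U i b B C A :
  measurable B -> measurable C -> measurable A ->
  P (W @^-1` B `&` sample @^-1` C `&` ghost i @^-1` A `&` Uev i b) =
  P (W @^-1` B `&` sample @^-1` C) * mu A * (2^-1)%:E.
Proof.
move=> mB mC mA; have [_ _ _ Wlaw] := model.
have WE (D : set (n.-tuple ((X * Y) * (X * Y)) * n.-tuple bool)) :
    measurable D -> P ((fun w => (Zt w, U w)) @^-1` D `&` W @^-1` B) =
    \int[P]_(w in (fun w => (Zt w, U w)) @^-1` D) Alg (sample w) B.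
  by move=> mD; exact: Wlaw.
have mSC := preimage_measurable mS mC.
have mE : measurable (ghost i @^-1` A `&` Uev i b).
  by apply: measurableI; [exact: (preimage_measurable (mG i))|exact: measurable_Uev].
have mselC := preimage_measurable (@measurable_select _ _ X Y n) mC.
have PE : P (ghost i @^-1` A `&` Uev i b) = mu A * (2^-1)%:E.
  have := sample_ghost_U i b measurableT mA.
  rewrite preimage_setT setTI => ->.
  by rewrite [X in X * _ * _](probability_setT P) mul1e.
have indep D : measurable D ->
    P (sample @^-1` D `&` (ghost i @^-1` A `&` Uev i b)) =
    P (sample @^-1` D) * P (ghost i @^-1` A `&` Uev i b).
  by move=> mD; rewrite setIA sample_ghost_U// PE muleA.
(* The constraint [C] moves into the integrand, so that the domain of integration is only the event
   independent of [sample]. *)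
pose f s := (\1_C s)%:E * Alg s B.
have mf : measurable_fun setT f.
  apply: emeasurable_funM; last exact: measurable_kernel.
  exact/measurable_EFinP.
have f0 s : 0 <= f s by apply: mule_ge0 => //; rewrite lee_fin.
have restr (E : set O) : measurable E ->
    \int[P]_(o in sample @^-1` C `&` E) Alg (sample o) B =
    \int[P]_(o in E) f (sample o).
  move=> mE'; rewrite [LHS]integral_mkcond [RHS]integral_mkcond.
  apply: eq_integral => o _; rewrite !patchE in_setI /f indicE.
  have -> : (sample o \in C) = (o \in sample @^-1` C).
    by apply/idP/idP => /set_mem ?; exact/mem_set.
  by case: (o \in sample @^-1` C); case: (o \in E); rewrite ?mul1e ?mul0e.
have := ge0_integral_indep mS mE indep mf f0.
rewrite PE -restr// -[in X in _ = _ * X]/(integral P setT _) -restr// setIT.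
(* The same event written as a set of values of the pair [(Zt, U)], the form in which the model
   specifies the law of [W]. *)
pose D1 := [set zu : n.-tuple ((X * Y) * (X * Y)) * n.-tuple bool |
  C (select_sample zu.1 zu.2)] `&` (@ghost_of _ _ X Y n i @^-1` A `&`
     (fun zu => tnth zu.2 i) @^-1` [set b]).
have mD1 : measurable D1.
  apply: measurableI => //; apply: measurableI.
    exact: (preimage_measurable (measurable_ghost_of i)).
  exact: (preimage_measurable (measurableT_comp (measurable_tnth i) measurable_snd)).
have := WE _ mD1; have := WE _ mselC.
rewrite -[X in P (X `&` _) = \int[P]_(w in X) _]/(sample @^-1` C) => <-.
rewrite -[X in P (X `&` _) = \int[P]_(w in X) _]/(sample @^-1` C `&` (ghost i @^-1` A `&` Uev i b)) => <-.
rewrite setIC !setIA => ->; rewrite muleC muleA; congr (_ * _ * _).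
by rewrite setIC.
Qed.

End SupersampleJointLaw.

(** * Mutual information with a fair binary selector *)

Section BinarySelector.
Context {R : realType} {dO : measure_display} {O : measurableType dO}
  (P : probability O R).

Lemma Rintegral_split (V : O -> bool) (f : O -> R) :
  measurable_fun setT V -> P.-integrable setT (EFin \o f) ->
  \int[P]_o f o = \int[P]_(o in V @^-1` [set true]) f o +
                  \int[P]_(o in V @^-1` [set false]) f o.
Proof.
move=> mV fi.
have mVb b : measurable (V @^-1` [set b]).
  by rewrite -[X in measurable X]setTI; exact: mV.
have E : V @^-1` [set true] `|` V @^-1` [set false] = setT.
  by apply/seteqP; split=> // o _ /=; case: (V o); [left|right].
rewrite -Rintegral_setU ?E//.
by apply/disj_set2P/seteqP; split=> // o /= [->].
Qed.

Lemma Rintegral_bool (nu : probability bool R) (f : bool -> R) :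
  \int[nu]_u f u = fine (nu [set true]) * f true + fine (nu [set false]) * f false.
Proof.
pose M := `|f true| + `|f false|.
have fM u : `|f u| <= M by case: u; rewrite /M ?lerDl ?lerDr.
have mf : measurable_fun setT f by [].
have fi := bounded_integrable nu mf fM.
have E : [set true] `|` [set false] = [set: bool].
  by apply/seteqP; split=> // -[] _; [left|right].
have cst1 b : \int[nu]_(u in [set b]) f u = fine (nu [set b]) * f b.
  rewrite mulrC -Rintegral_cst//.
  by apply: eq_Rintegral => u /set_mem ->.
rewrite -E Rintegral_setU ?E ?cst1//.
by apply/disj_set2P/seteqP; split=> // o /= [->].
Qed.

End BinarySelector.

Section MutualInformationBound.
Context {R : realType} {dO : measure_display} {O : measurableType dO}
  (P : probability O R) (L : O -> R) (V : O -> bool).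
Hypotheses (mL : measurable_fun setT L) (mV : measurable_fun setT V).
Hypothesis Vlaw : forall b, P (V @^-1` [set b]) = (2^-1)%:E.

Let joint : probability (R * bool)%type R := law P (measurable_fun_pair mL mV).
Let prod : probability (R * bool)%type R := (law P mL \x law P mV)%E.

Lemma MI_KL : MI P L V = KL joint prod.
Proof. by []. Qed.

Lemma MI_ge_selector_gap : (forall o, 0 <= L o <= 1) ->
  ((`|\int[P]_(o in V @^-1` [set true]) L o -
     \int[P]_(o in V @^-1` [set false]) L o|)%:E <= sqrte (2%:E * MI P L V))%E.
Proof.
move=> L01; rewrite MI_KL.
(* Pinsker's inequality asks for a test function bounded on the whole line, whereas only the values
   of [L] lie in the unit interval; clipping changes nothing along [L]. *)
pose cl (l : R) := Num.max 0 (Num.min l 1).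
have cl01 l : 0 <= cl l <= 1.
  by rewrite /cl le_max lexx/= ge_max ler01/= ge_min lexx orbT.
have clL o : cl (L o) = L o.
  by have /andP[L0 L1] := L01 o; rewrite /cl min_l// max_r.
have mcl : measurable_fun setT cl.
  by apply: measurable_maxr => //; apply: measurable_minr.
pose g (p : R * bool) := if p.2 then cl p.1 else - cl p.1.
have mg : measurable_fun setT g.
  have mc : measurable_fun setT (fun p : R * bool => cl p.1).
    exact: (measurableT_comp mcl measurable_fst).
  apply: measurable_fun_ifT => //; exact: (measurable_funN mc).
have g1 p : `|g p| <= 1.
  by rewrite /g; have /andP[c0 c1] := cl01 p.1; case: p.2; rewrite ?normrN ger0_norm.
have := pinsker joint prod mg g1.
have -> : \int[prod]_p g p = 0.
  have gi := bounded_integrable prod mg g1.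
  rewrite /Rintegral -integral12_prod_meas1//.
  rewrite integral0_eq// => l _; rewrite /fubini_F.
  have gli : (law P mV).-integrable setT (EFin \o (fun u => g (l, u))).
    by apply: (bounded_integrable _ (M := 1)).
  rewrite -[LHS]fineK; last exact: integrable_fin_num.
  have := Rintegral_bool (law P mV) (fun u => g (l, u)).
  rewrite /Rintegral => ->.
  have E b : law P mV [set b] = (2^-1)%:E by exact: Vlaw.
  by rewrite !E/= /g/= mulrN subrr.
have -> : \int[joint]_p g p = \int[P]_o (if V o then L o else - L o).
  have mf : measurable_fun setT (fun o => (L o, V o)) by exact: measurable_fun_pair.
  rewrite /Rintegral integral_pushforward//.
  - by congr fine; apply: eq_integral => o _; rewrite /g/= clL.
  - exact/measurable_EFinP.
  - by apply: (bounded_integrable _ (M := 1)) => [|o]; [exact: measurableT_comp|exact: g1].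
rewrite subr0 (Rintegral_split mV); last first.
  apply: (bounded_integrable _ (M := 1)) => [|o].
    by apply: measurable_fun_ifT => //; exact: measurable_funN.
  by have /andP[c0 c1] := L01 o; case: (V o); rewrite ?normrN ger0_norm.
have mVb b : measurable (V @^-1` [set b]).
  by rewrite -[X in measurable X]setTI; exact: mV.
have -> : \int[P]_(o in V @^-1` [set true]) (if V o then L o else - L o) =
    \int[P]_(o in V @^-1` [set true]) L o.
  by apply: eq_Rintegral => o /set_mem /= ->.
have -> // : \int[P]_(o in V @^-1` [set false]) (if V o then L o else - L o) =
    - \int[P]_(o in V @^-1` [set false]) L o.
rewrite -mulN1r -RintegralZl//.
  by apply: eq_Rintegral => o /set_mem /= ->; rewrite mulN1r.
apply: (integrableS measurableT) => //.
apply: (bounded_integrable _ (M := 1)) => // o.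
by have /andP[c0 c1] := L01 o; rewrite ger0_norm.
Qed.

End MutualInformationBound.

(** * Risk identities and the first inequality *)

Section SupersampleRisk.
Context {R : realType} {dO dX dY dW : measure_display}
  {O : measurableType dO} {X : measurableType dX} {Y : measurableType dY}
  {Wt : measurableType dW} {n : nat} (P : probability O R)
  (mu : probability (X * Y)%type R)
  (Alg : R.-pker (n.-tuple (X * Y)%type) ~> Wt)
  (Zt : O -> n.-tuple ((X * Y) * (X * Y))) (U : O -> n.-tuple bool)
  (W : O -> Wt).
Hypotheses (mZt : measurable_fun setT Zt) (mU : measurable_fun setT U)
  (mW : measurable_fun setT W) (model : supersample_model P mu Alg Zt U W).
Local Open Scope ereal_scope.

Local Notation sample := (train_sample Zt U).
Local Notation ghost := (ghost_point Zt U).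
Local Notation Uev i b := ((fun o => tnth (U o) i) @^-1` [set b]).
Local Notation mS := (measurable_sample mZt mU).
Local Notation mG i := (measurable_ghost mZt mU i).

Lemma W_ghost_U i b B A : measurable B -> measurable A ->
  P (W @^-1` B `&` ghost i @^-1` A `&` Uev i b) =
  P (W @^-1` B) * mu A * (2^-1)%:E.
Proof.
move=> mB mA.
have := W_sample_ghost_U mZt mU model i b mB measurableT mA.
by rewrite preimage_setT setIT.
Qed.

Lemma W_ghost i B A : measurable B -> measurable A ->
  P (W @^-1` B `&` ghost i @^-1` A) = P (W @^-1` B) * mu A.
Proof.
move=> mB mA.
have mE : measurable (W @^-1` B `&` ghost i @^-1` A).
  apply: measurableI; first exact: (preimage_measurable mW).
  exact: (preimage_measurable (mG i)).
have PU (D E : set O) : measurable D -> measurable E -> D `&` E = set0 ->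
    P (D `|` E) = P D + P E by move=> *; exact: measureU.
have -> : W @^-1` B `&` ghost i @^-1` A =
   (W @^-1` B `&` ghost i @^-1` A `&` Uev i true) `|`
   (W @^-1` B `&` ghost i @^-1` A `&` Uev i false).
  rewrite -setIUr (_ : _ `|` _ = setT) ?setIT//.
  by apply/seteqP; split=> // o _; case E: (tnth (U o) i); [left|right].
rewrite PU.
- rewrite !W_ghost_U// -ge0_muleDr// -EFinD (_ : 2^-1 + 2^-1 = 1)%R ?mule1//; lra.
- by apply: measurableI => //; exact: (measurable_Uev mU).
- by apply: measurableI => //; exact: (measurable_Uev mU).
- by apply/seteqP; split=> // o [[_ /= ->] [_ /=]].
Qed.

Variable ell : Wt -> X * Y -> R.
Hypothesis mell : measurable_fun setT (fun p : Wt * (X * Y) => ell p.1 p.2).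
Hypothesis ell0 : forall w z, (0 <= ell w z)%R.

Let f (p : Wt * (X * Y)) : \bar R := (ell p.1 p.2)%:E.
Let mf : measurable_fun setT f. Proof. exact/measurable_EFinP. Qed.
Let f0 p : 0 <= f p. Proof. by rewrite lee_fin. Qed.

(** The left-out point is a fresh test point: the law of [(W, ghost i)] is the mixture over [o] of
    the images of [mu] under pairing with [W o], which is checked on rectangles. *)
Lemma loss_ghost i : \int[P]_o (ell (W o) (ghost i o))%:E =
  \int[P]_o \int[mu]_z (ell (W o) z)%:E.
Proof.
have mWG : measurable_fun setT (fun o => (W o, ghost i o)).
  exact: measurable_fun_pair mW (mG i).
pose k o : probability (Wt * (X * Y))%type R :=
  law mu (pair1_measurable (W o) : measurable_fun [set: X * Y] (pair (W o))).
have kE o B A : k o (B `*` A) = (\1_B (W o))%:E * mu A.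
  rewrite indicE; have [/set_mem WB|WB] := boolP (W o \in B).
    rewrite mul1e /k lawE /pushforward; congr (mu _).
    by apply/seteqP; split=> z //= [].
  rewrite mul0e /k lawE /pushforward (_ : _ @^-1` _ = set0) ?measure0//.
  by apply/seteqP; split=> z //= [WB' _]; move/negP: WB; apply; exact/mem_set.
have gen := pi_generator_rectangles Wt (X * Y)%type.
have [TG GI _] := gen.
have H := @mixture_of_generator _ _ _ _ _ P (law P mWG) k _ TG GI.
have {}H A : measurable A -> measurable_fun setT (fun o => k o A) /\
    law P mWG A = \int[P]_o k o A.
  apply: H.
  - move=> _ [B mB [C mC <-]]; under eq_fun do rewrite kE.
    apply: emeasurable_funM => //; apply/measurable_EFinP.
    exact: (measurableT_comp (measurable_indic mB) mW).
  - move=> _ [B mB [C mC <-]]; under eq_integral do rewrite kE.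
    rewrite lawE /pushforward preimage_pair W_ghost// ge0_integralZr//; last first.
      apply/measurable_EFinP.
      exact: (measurableT_comp (measurable_indic mB) mW).
    congr (_ * _); rewrite -[in LHS](setIT (W @^-1` B)) -integral_indic//.
    exact: (preimage_measurable mW).
have [_ E] := @integral_mixture _ _ _ _ _ P (law P mWG) k f
  (fun A mA => (H A mA).1) (fun A mA => (H A mA).2) mf f0.
rewrite (ge0_integral_law P mWG mf f0) in E; rewrite [LHS]E.
by apply: eq_integral => o _; rewrite ge0_integral_law.
Qed.

Lemma loss_ghost_U i b : \int[P]_(o in Uev i b) (ell (W o) (ghost i o))%:E =
  (2^-1)%:E * \int[P]_o \int[mu]_z (ell (W o) z)%:E.
Proof.
have mWG : measurable_fun setT (fun o => (W o, ghost i o)).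
  exact: measurable_fun_pair mW (mG i).
have mUb := measurable_Uev mU i b.
rewrite -(loss_ghost i) -(Uev_probability mU model i b).
apply: (ge0_integral_indep mWG mUb _ mf f0).
apply: (indep_of_generator mWG mUb (pi_generator_rectangles _ _)).
move=> _ [B mB [A mA <-]]; rewrite preimage_pair W_ghost_U// W_ghost//.
by rewrite (Uev_probability mU model i b).
Qed.

(** The bit [U_i] is independent of the hypothesis and the sample taken together: they do not reveal
    from which entry of the pair the training point was drawn. *)
Lemma loss_sample_U i b :
  \int[P]_(o in Uev i b) (ell (W o) (tnth (sample o) i))%:E =
  (2^-1)%:E * \int[P]_o (ell (W o) (tnth (sample o) i))%:E.
Proof.
have mWS : measurable_fun setT (fun o => (W o, sample o)).
  exact: measurable_fun_pair mW mS.
have mUb := measurable_Uev mU i b.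
pose h (p : Wt * n.-tuple (X * Y)%type) : \bar R := f (p.1, tnth p.2 i).
have mh : measurable_fun setT h.
  apply: (measurableT_comp mf); apply: measurable_fun_pair => //.
  exact: (measurableT_comp (measurable_tnth i) measurable_snd).
rewrite -(Uev_probability mU model i b).
apply: (ge0_integral_indep mWS mUb (f := h) _ mh (fun p => f0 _)).
apply: (indep_of_generator mWS mUb (pi_generator_rectangles _ _)).
move=> _ [B mB [C mC <-]]; rewrite preimage_pair (Uev_probability mU model i b).
have := W_sample_ghost_U mZt mU model i b mB mC measurableT.
rewrite preimage_setT setIT => ->.
by rewrite [X in _ * X * _](probability_setT mu) mule1.
Qed.

Hypothesis ell1 : forall w z, (ell w z <= 1)%R.

Let ell_int (V : O -> X * Y) : measurable_fun setT V ->
  P.-integrable setT (fun o => (ell (W o) (V o))%:E).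
Proof.
move=> mV; apply: (bounded_integrable P (M := 1)) => [|o].
  exact: (measurableT_comp mell (measurable_fun_pair mW mV)).
by rewrite ger0_norm.
Qed.

Lemma generalization_gap_le i :
  `| \int[P]_o \int[mu]_z (ell (W o) z)%:E -
     \int[P]_o (ell (W o) (tnth (sample o) i))%:E | <=
  2%:E * sqrte (2%:E * MI P (fun o => ell (W o) (tnth (Zt o) i).1)
                     (fun o => tnth (U o) i)).
Proof.
have mZi : measurable_fun setT (fun o => (tnth (Zt o) i).1).
  exact: (measurableT_comp (measurable_zproj i false) mZt).
have mL : measurable_fun setT (fun o => ell (W o) (tnth (Zt o) i).1).
  exact: (measurableT_comp mell (measurable_fun_pair mW mZi)).
have mSi : measurable_fun setT (fun o => tnth (sample o) i).
  exact: (measurableT_comp (measurable_tnth i) mS).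
have L01 o : (0 <= ell (W o) (tnth (Zt o) i).1 <= 1)%R by rewrite ell0 ell1.
have := MI_ge_selector_gap mL (measurable_tnthU mU i)
  (fun b => Uev_probability mU model i b) L01.
have Ltrue : \int[P]_(o in Uev i true) (ell (W o) (tnth (Zt o) i).1)%:E =
    \int[P]_(o in Uev i true) (ell (W o) (ghost i o))%:E.
  by apply: eq_integral => o /set_mem /= oi; rewrite /ghost_point oi.
have Lfalse : \int[P]_(o in Uev i false) (ell (W o) (tnth (Zt o) i).1)%:E =
    \int[P]_(o in Uev i false) (ell (W o) (tnth (sample o) i))%:E.
  by apply: eq_integral => o /set_mem /= oi; rewrite tnth_select oi.
rewrite /Rintegral Ltrue Lfalse loss_ghost_U loss_sample_U -(loss_ghost i).
have /fineK <- := integrable_fin_num measurableT (ell_int (mG i)).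
have /fineK <- := integrable_fin_num measurableT (ell_int mSi).
rewrite -!EFinM/= -mulrBr normrM ger0_norm ?invr_ge0// => H.
rewrite -lee_pdivrMl// -EFinM; exact: H.
Qed.

Lemma generalization_error_le : (0 < n)%N ->
  `| \int[P]_o \int[mu]_z (ell (W o) z)%:E -
     \int[P]_o (n%:R^-1 * \sum_(i < n) ell (W o) (tnth (sample o) i))%:E | <=
  (2 / n%:R)%:E *
   \sum_(i < n) sqrte (2%:E * MI P (fun o => ell (W o) (tnth (Zt o) i).1)
                     (fun o => tnth (U o) i)).
Proof.
move=> n0; have nR : (0 < n%:R :> R)%R by rewrite ltr0n.
set Lmu := \int[P]_o \int[mu]_z _.
have mSi i : measurable_fun setT (fun o => tnth (sample o) i).
  exact: (measurableT_comp (measurable_tnth i) mS).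
pose e i := \int[P]_o (ell (W o) (tnth (sample o) i))%:E.
have -> : \int[P]_o (n%:R^-1 * \sum_(i < n) ell (W o) (tnth (sample o) i))%:E =
    (n%:R^-1)%:E * \sum_(i < n) e i.
  under eq_integral do rewrite EFinM -sumEFin.
  have me i : measurable_fun setT (fun o => (ell (W o) (tnth (sample o) i))%:E).
    exact: (measurable_int P (ell_int (mSi i))).
  have ms : measurable_fun setT
      (fun o => \sum_(i < n) (ell (W o) (tnth (sample o) i))%:E).
    exact: emeasurable_sum.
  rewrite (ge0_integralZl _ _ ms) ?lee_fin ?invr_ge0//; last first.
    by move=> o _; apply: sume_ge0 => i _; rewrite lee_fin.
  by rewrite ge0_integral_sum// => i o _; rewrite lee_fin.
(* Finiteness of the double integral is read off its expression through a left-out point; [0 < n]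
   supplies the index. *)
have Lmu_fin : Lmu \is a fin_num.
  rewrite /Lmu -(loss_ghost (Ordinal n0)).
  exact: (integrable_fin_num measurableT (ell_int (mG _))).
have e_fin i : e i \is a fin_num.
  exact: (integrable_fin_num measurableT (ell_int (mSi _))).
have -> : Lmu - (n%:R^-1)%:E * \sum_(i < n) e i =
    (n%:R^-1)%:E * \sum_(i < n) (Lmu - e i).
  rewrite -(fineK Lmu_fin).
  have eE i : e i = (fine (e i))%:E by rewrite fineK.
  under eq_bigr do rewrite eE.
  under [in RHS]eq_bigr do rewrite eE -EFinB.
  rewrite !sumEFin -!EFinM -EFinB; congr EFin.
  have nK : (n%:R^-1 * (fine Lmu *+ n) = fine Lmu)%R.
    by rewrite -[(fine Lmu *+ n)%R]mulr_natl mulKf// gt_eqF.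
  by rewrite sumrB sumr_const card_ord mulrBr nK.
rewrite abseM gee0_abs ?lee_fin ?invr_ge0//.
rewrite (mulrC 2%R) EFinM -muleA lee_pmul2l// ?lte_fin ?invr_gt0//.
apply: (le_trans (lee_abs_sum _ _ _)).
rewrite ge0_sume_distrr; last by move=> i _; exact: sqrte_ge0.
apply: lee_sum => i _; exact: generalization_gap_le.
Qed.

End SupersampleRisk.

Lemma measurable_ln_comp d (T : measurableType d) (R : realType) (h : T -> R) :
  measurable_fun setT h -> measurable_fun setT (fun x => ln (h x)).
Proof. by move=> mh; exact: measurableT_comp. Qed.

(** * Unconditional and conditional mutual information *)

Section BoundedDensity.
Context {R : realType} {d : measure_display} {T : measurableType d}.

Lemma density_exists (P Q : probability T R) (c : R) : 0 <= c ->
  (forall A, measurable A -> P A <= c%:E * Q A)%E -> exists h, is_density P Q h.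
Proof.
move=> c0 PQ.
have dom : P `<< Q.
  apply/null_content_dominatesP => A mA QA0; apply/eqP; rewrite eq_le measure_ge0 andbT.
  by rewrite (le_trans (PQ A mA))// QA0 mule0.
have [f [f0 ffin fint fE]] := radon_nikodym_sigma_finite dom.
exists (fun x => fine (f x)); split.
- exact: (measurableT_comp (fine_measurable measurableT) (measurable_int Q fint)).
- by move=> x; rewrite fine_ge0.
- by move=> A mA; rewrite fE//; apply: eq_integral => x _; rewrite fineK.
Qed.

(** A density can exceed [c] only on a [Q]-null set, so truncating the version chosen by [KL] at [c]
    gives another version with the same divergence. The bound then holds at every point, as is
    required of a test function used under other measures. *)
Lemma KL_bounded_density (P Q : probability T R) (c : R) : 0 <= c ->
  (forall A, measurable A -> P A <= c%:E * Q A)%E ->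
  exists h, [/\ is_density P Q h, forall x, h x <= c &
    KL P Q = (\int[Q]_x (h x * ln (h x))%:E)%E].
Proof.
move=> c0 PQ; have ex := density_exists c0 PQ.
rewrite /KL; case: pselect => // {}ex; case: (cid ex) => h Ph /=.
have [mh h0 hP] := Ph.
pose h' x := Num.min (h x) c.
have mh' : measurable_fun setT h' by apply: measurable_minr.
pose A := [set x | c < h x].
have mA : measurable A.
  rewrite (_ : A = h @^-1` `]c, +oo[); last first.
    by apply/seteqP; split=> x /=; rewrite in_itv/= andbT.
  by rewrite -[X in measurable X]setTI; exact: mh.
have mhA : measurable_fun A (fun x => (h x - c)%:E).
  by apply/measurable_EFinP; apply: measurable_funTS; exact: measurable_funB.
have hi : Q.-integrable setT (EFin \o h).
  apply/integrableP; split; first exact/measurable_EFinP.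
  under eq_integral do rewrite /= ger0_norm//.
  by rewrite -hP// ltey_eq fin_num_measure.
(* The excess of [h] over [c] on [A] integrates to [P A - c * Q A], which is at most 0 by
   domination. *)
have A0 : (\int[Q]_(x in A) `|(h x - c)%:E| = 0)%E.
  apply/eqP; rewrite eq_le integral_ge0// andbT.
  have -> : (\int[Q]_(x in A) `|(h x - c)%:E| = \int[Q]_(x in A) ((h x)%:E - c%:E))%E.
    apply: eq_integral => x /set_mem /= hx.
    by rewrite /= ger0_norm ?EFinB// subr_ge0 ltW.
  rewrite integralB//.
  - rewrite -hP// integral_cst// sube_le0; exact: PQ.
  - exact: (integrableS measurableT).
  - by apply: (integrableS measurableT) => //; exact: finite_measure_integrable_cst.
have hh' : ae_eq Q setT h h'.
  have := (ae_eq_integral_abs Q mA mhA).1 A0.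
  apply: filterS => x H _; rewrite /h' /=.
  have [hc|hc] := leP (h x) c => //.
  by have [/eqP] := H hc; rewrite subr_eq0 => /eqP.
have eE (D : set T) (u : R -> R) : measurable D -> measurable_fun setT (u \o h) ->
    measurable_fun setT (u \o h') ->
    (\int[Q]_(x in D) (u (h x))%:E = \int[Q]_(x in D) (u (h' x))%:E)%E.
  move=> mD m1 m2; apply: ae_eq_integral => //.
  - by apply/measurable_EFinP; exact: measurable_funTS.
  - by apply/measurable_EFinP; exact: measurable_funTS.
  - by apply: filterS hh' => x H Dx; rewrite H.
exists h'; split.
- split => //; first by move=> x; rewrite /h' le_min h0 c0.
  by move=> B mB; rewrite hP// (eE B id).
- by move=> x; rewrite /h' ge_min lexx orbT.
- apply: (eE setT (fun t => t * ln t)) => //.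
  + by apply: measurable_funM => //; exact: measurable_ln_comp.
  + by apply: measurable_funM => //; exact: measurable_ln_comp.
Qed.

Local Open Scope ereal_scope.

Lemma ge0_integral_bool (nu : {measure set bool -> \bar R}) (f : bool -> \bar R) :
  (forall u, 0 <= f u) ->
  \int[nu]_u f u = nu [set true] * f true + nu [set false] * f false.
Proof.
move=> f0.
have E : [set true] `|` [set false] = [set: bool].
  by apply/seteqP; split=> // -[] _; [left|right].
have cst1 b : \int[nu]_(u in [set b]) f u = nu [set b] * f b.
  have -> : \int[nu]_(u in [set b]) f u = \int[nu]_(u in [set b]) (f b * 1).
    by apply: eq_integral => u /set_mem ->; rewrite mule1.
  by rewrite ge0_integralZl// integral_cst// mul1e muleC.
rewrite -E ge0_integral_setU ?E ?cst1//.
by apply/disj_set2P/seteqP; split=> // o /= [->].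
Qed.

Lemma ge0_integral_prod_bool (m : probability T R) (nu : probability bool R)
    (f : T * bool -> \bar R) : measurable_fun setT f -> (forall p, 0 <= f p) ->
  \int[m \x nu]_p f p = nu [set true] * \int[m]_x f (x, true) +
                        nu [set false] * \int[m]_x f (x, false).
Proof.
move=> mf f0; rewrite fubini_tonelli2// ge0_integral_bool//.
by move=> u; apply: integral_ge0.
Qed.

End BoundedDensity.

(** * Integration against a regular conditional distribution *)

Section KernelProbability.
Context {R : realType} {d1 d2 : measure_display} {T1 : measurableType d1}
  {T2 : measurableType d2} (kappa : R.-pker T1 ~> T2).

(** A name for [kappa z] on which a probability instance can be declared; it stays convertible to
    [kappa z], so results on [KL] apply to the integrand of [CMI] as it is written. *)
Definition pker_measure (z : T1) : set T2 -> \bar R := kappa z.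

HB.instance Definition _ z := Measure.copy (pker_measure z) (kappa z).

HB.instance Definition _ z := Measure_isProbability.Build _ _ _
  (pker_measure z) (prob_kernel z).

Definition pker_probability (z : T1) : probability T2 R := pker_measure z.

End KernelProbability.

Section CondLaw.
Context {R : realType} {dO dT dZ : measure_display} {O : measurableType dO}
  {T : measurableType dT} {TZ : measurableType dZ} (P : probability O R)
  (Zv : O -> TZ) (AB : O -> T) (kappa : R.-pker TZ ~> T).
Hypotheses (mZv : measurable_fun setT Zv) (mAB : measurable_fun setT AB).
Hypothesis kappaP : cond_law P Zv AB kappa.
Local Open Scope ereal_scope.

(** The joint law of [(Zv, AB)] is the mixture, over the law of [Zv], of the images of [kappa z]
    under pairing with [z]; [cond_law] is this identity on rectangles. *)
Lemma cond_law_integral (f : TZ * T -> \bar R) :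
  measurable_fun setT f -> (forall p, 0 <= f p) ->
  measurable_fun setT (fun z => \int[kappa z]_p f (z, p)) /\
  \int[P]_o f (Zv o, AB o) = \int[P]_o \int[kappa (Zv o)]_p f (Zv o, p).
Proof.
move=> mf f0.
have mZAB : measurable_fun setT (fun o => (Zv o, AB o)).
  exact: measurable_fun_pair.
pose k z : probability (TZ * T)%type R := law (pker_probability kappa z)
  (pair1_measurable z : measurable_fun [set: T] (pair z)).
have kE z C D : k z (C `*` D) = (\1_C z)%:E * kappa z D.
  rewrite indicE; have [/set_mem zC|zC] := boolP (z \in C).
    rewrite mul1e /k lawE /pushforward; congr (kappa z _).
    by apply/seteqP; split=> p //= [].
  rewrite mul0e /k lawE /pushforward (_ : _ @^-1` _ = set0) ?measure0//.
  by apply/seteqP; split=> p //= [zC' _]; move/negP: zC; apply; exact/mem_set.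
have [TG GI _] := pi_generator_rectangles TZ T.
have mkC C D : measurable C -> measurable D ->
    measurable_fun setT (fun z => (\1_C z)%:E * kappa z D).
  move=> mC mD; apply: emeasurable_funM; last exact: measurable_kernel.
  exact/measurable_EFinP/measurable_indic.
have H A : measurable A -> measurable_fun setT (fun z => k z A) /\
    law P mZAB A = \int[law P mZv]_z k z A.
  apply: (mixture_of_generator TG GI).
  - move=> _ [C mC [D mD <-]]; under eq_fun do rewrite kE.
    exact: mkC.
  - move=> _ [C mC [D mD <-]]; under eq_integral do rewrite kE.
    rewrite lawE /pushforward preimage_pair kappaP//.
    rewrite ge0_integral_law//; last exact: mkC.
    rewrite integral_mkcond; apply: eq_integral => o _.
    rewrite patchE indicE.
    have -> : (Zv o \in C) = (o \in Zv @^-1` C).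
      by apply/idP/idP => /set_mem ?; exact/mem_set.
    by case: ifP; rewrite ?mul1e ?mul0e.
have kfE z : \int[k z]_p f p = \int[kappa z]_p f (z, p).
  exact: (ge0_integral_law (pker_probability kappa z) (pair1_measurable z) mf f0).
have [mkf E] := @integral_mixture _ _ _ _ _ (law P mZv) (law P mZAB) k f
  (fun A mA => (H A mA).1) (fun A mA => (H A mA).2) mf f0.
have mkf' : measurable_fun setT (fun z => \int[kappa z]_p f (z, p)).
  by move: mkf; under eq_fun do rewrite kfE.
split=> //; move: E.
rewrite (ge0_integral_law P mZAB mf f0) => ->.
under eq_integral do rewrite kfE.
by rewrite ge0_integral_law// => z; apply: integral_ge0.
Qed.

End CondLaw.

Lemma integral_shift (R : realType) d (T : measurableType d)
    (m : probability T R) (f : T -> R) (M c : R) :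
  measurable_fun setT f -> (forall x, `|f x| <= M) ->
  (\int[m]_x (f x + c)%:E = (\int[m]_x f x + c)%:E)%E.
Proof.
move=> mf fM; have fi := bounded_integrable m mf fM.
have ci : m.-integrable setT (EFin \o cst c) by exact: finite_measure_integrable_cst.
have fci := integrableD measurableT fi ci.
rewrite -[LHS]fineK; last exact: (integrable_fin_num measurableT fci).
congr EFin; rewrite -[LHS]/(Rintegral m setT (fun x => f x + cst c x)) RintegralD//.
rewrite Rintegral_cst//; congr (_ + _).
by rewrite -[RHS]mulr1; congr (_ * _); exact: (congr1 fine (probability_setT m)).
Qed.

(** * Comparison of [MI] with [CMI] *)

Section MILeCMI.
Context {R : realType} {dO dT dZ : measure_display} {O : measurableType dO}
  {T : measurableType dT} {TZ : measurableType dZ} (P : probability O R)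
  (Zv : O -> TZ) (F : O -> T) (V : O -> bool)
  (kappa : R.-pker TZ ~> (T * bool)%type) (psi : TZ -> T -> R).
Hypotheses (mZv : measurable_fun setT Zv) (mF : measurable_fun setT F)
  (mV : measurable_fun setT V)
  (mpsi : measurable_fun setT (fun p : TZ * T => psi p.1 p.2)).
Hypothesis Vlaw : forall b, P (V @^-1` [set b]) = (2^-1)%:E.
Hypothesis ZV_indep : forall C b, measurable C ->
  (P (Zv @^-1` C `&` V @^-1` [set b]) = P (Zv @^-1` C) * P (V @^-1` [set b]))%E.
Hypothesis kappaP : cond_law P Zv (fun o => (F o, V o)) kappa.
Local Open Scope ereal_scope.

Let L o := psi (Zv o) (F o).

Let mL : measurable_fun setT L.
Proof. exact: (measurableT_comp mpsi (measurable_fun_pair mZv mF)). Qed.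

Let joint : probability (R * bool)%type R := law P (measurable_fun_pair mL mV).
Let prod : probability (R * bool)%type R := law P mL \x law P mV.

Let margins z : probability (T * bool)%type R :=
  law (pker_probability kappa z) measurable_fst \x
  law (pker_probability kappa z) measurable_snd.

Lemma CMI_KL : CMI P Zv kappa =
  \int[P]_o KL (pker_probability kappa (Zv o)) (margins (Zv o)).
Proof. by []. Qed.

Lemma CMI_ge0 : 0 <= CMI P Zv kappa.
Proof. by rewrite CMI_KL; apply: integral_ge0 => o _; exact: KL_ge0. Qed.

Let prod_integral (g : R * bool -> \bar R) :
  measurable_fun setT g -> (forall p, 0 <= g p) ->
  \int[prod]_p g p = (2^-1)%:E * \int[P]_o g (L o, true) +
                     (2^-1)%:E * \int[P]_o g (L o, false).
Proof.
move=> mg g0; rewrite /prod ge0_integral_prod_bool//.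
have mgu u : measurable_fun setT (fun l => g (l, u)).
  exact: measurable_fun_pair1.
rewrite (ge0_integral_law P mL (mgu true))// (ge0_integral_law P mL (mgu false))//.
have E b : law P mV [set b] = (2^-1)%:E by exact: Vlaw.
by rewrite !E.
Qed.

(** Integrating the indicator of [A] against [2 * prod] adds up its values at [(L, true)] and
    [(L, false)], one of which is its value at [(L, V)]. The factor 2 is the inverse of the mass of
    each selector value. *)
Let joint_le A : measurable A -> joint A <= 2%:E * prod A.
Proof.
move=> mA.
have mi : measurable_fun setT (fun p : R * bool => (\1_A p : R)%:E).
  exact/measurable_EFinP/measurable_indic.
have i0 (p : R * bool) : 0 <= (\1_A p : R)%:E by rewrite lee_fin.
have mi' u : measurable_fun setT (fun o => (\1_A (L o, u) : R)%:E).
  exact: (measurableT_comp mi (measurable_fun_pair mL (measurable_cst u))).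
have -> : joint A = \int[P]_o (\1_A (L o, V o))%:E.
  rewrite -[A in LHS]setIT -integral_indic//.
  exact: (ge0_integral_law P (measurable_fun_pair mL mV) mi).
have -> : prod A = \int[prod]_p (\1_A p)%:E by rewrite integral_indic// setIT.
rewrite prod_integral// -ge0_muleDr; [|exact: integral_ge0..].
rewrite muleA -EFinM mulfV// mul1e -ge0_integralD//.
apply: integral_mono => o.
by case: (V o); rewrite ?leeDl ?leeDr.
Qed.

Section LossTest.
Variable g : R * bool -> \bar R.
Hypotheses (mg : measurable_fun setT g) (g0 : forall p, 0 <= g p).

Let mgpsi : measurable_fun setT
  (fun p : TZ * (T * bool) => g (psi p.1 p.2.1, p.2.2)).
Proof.
apply: (measurableT_comp mg); apply: measurable_fun_pair.
  have m1 : measurable_fun setT (fun p : TZ * (T * bool) => (p.1, p.2.1)).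
    by apply: measurable_fun_pair => //; exact: measurableT_comp.
  exact: (measurableT_comp mpsi m1).
exact: measurableT_comp.
Qed.

Let mgpsiu u : measurable_fun setT
  (fun p : TZ * (T * bool) => g (psi p.1 p.2.1, u)).
Proof.
apply: (measurableT_comp mg); apply: measurable_fun_pair => //.
have m1 : measurable_fun setT (fun p : TZ * (T * bool) => (p.1, p.2.1)).
  by apply: measurable_fun_pair => //; exact: measurableT_comp.
exact: (measurableT_comp mpsi m1).
Qed.

Lemma joint_integral :
  measurable_fun setT (fun o =>
    \int[kappa (Zv o)]_p g (psi (Zv o) p.1, p.2)) /\
  \int[joint]_p g p = \int[P]_o \int[kappa (Zv o)]_p g (psi (Zv o) p.1, p.2).
Proof.
have [mk E] := cond_law_integral mZv (measurable_fun_pair mF mV) kappaP mgpsi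
  (fun p => g0 _).
split; first exact: (measurableT_comp mk mZv).
by rewrite -E; exact: (ge0_integral_law P (measurable_fun_pair mL mV) mg).
Qed.

(** Summing out the selector splits the inner integral into the terms [N u z * phi u z], with
    [N u z] the conditional mass of [u] and [phi u z] the conditional mean of [g (L, u)]. *)
Lemma marginals_integral :
  measurable_fun setT (fun o =>
    \int[margins (Zv o)]_p
      g (psi (Zv o) p.1, p.2)) /\
  \int[prod]_p g p = \int[P]_o
    \int[margins (Zv o)]_p
      g (psi (Zv o) p.1, p.2).
Proof.
pose phi u z := \int[kappa z]_p g (psi z p.1, u).
pose N u z := kappa z (snd @^-1` [set u]).
have msnd u : measurable (snd @^-1` [set u] : set (T * bool)).
  exact: (preimage_measurable measurable_snd).
have mN u : measurable_fun setT (N u) by exact: measurable_kernel.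
have phi0 u z : 0 <= phi u z by exact: integral_ge0.
have mphi u : measurable_fun setT (phi u).
  by have [] := cond_law_integral mZv (measurable_fun_pair mF mV) kappaP
    (mgpsiu u) (fun p => g0 _).
have phiE u : \int[P]_o phi u (Zv o) = \int[P]_o g (L o, u).
  by have [_ <-] := cond_law_integral mZv (measurable_fun_pair mF mV) kappaP
    (mgpsiu u) (fun p => g0 _).
have QE z : \int[margins z]_p
      g (psi z p.1, p.2) = N true z * phi true z + N false z * phi false z.
  have mgz : measurable_fun setT (fun p : T * bool => g (psi z p.1, p.2)).
    exact: (measurableT_comp mgpsi (pair1_measurable z)).
  have mgzu u : measurable_fun setT (fun y : T => g (psi z y, u)).
    exact: (measurable_fun_pair1 u mgz).
  rewrite /margins ge0_integral_prod_bool//.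
  rewrite (ge0_integral_law _ measurable_fst (mgzu true))//.
  by rewrite (ge0_integral_law _ measurable_fst (mgzu false)).
(* No almost sure value of [N u] is needed: disintegration turns [N u (Zv o)] back into the
   indicator of [V = u], which is independent of [phi u (Zv o)] and has mean 1/2. *)
have NphiE u : \int[P]_o (N u (Zv o) * phi u (Zv o)) =
    (2^-1)%:E * \int[P]_o g (L o, u).
  pose f (p : TZ * (T * bool)) := phi u p.1 * (\1_[set u] p.2.2)%:E.
  have mf : measurable_fun setT f.
    apply: emeasurable_funM; first exact: (measurableT_comp (mphi u) measurable_fst).
    apply/measurable_EFinP.
    exact: (measurableT_comp (@measurable_indic _ _ R setT [set u] _)
      (measurableT_comp measurable_snd measurable_snd)).
  have f0 p : 0 <= f p by rewrite mule_ge0// lee_fin.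
  have [_ E] := cond_law_integral mZv (measurable_fun_pair mF mV) kappaP mf f0.
  transitivity (\int[P]_o f (Zv o, (F o, V o))).
    rewrite E; apply: eq_integral => o _; rewrite /f/= ge0_integralZl//.
    - rewrite muleC; congr (_ * _).
      rewrite /N -[X in _ _ X = _]setIT -(integral_indic (kappa (Zv o)) measurableT (msnd u)).
      apply: eq_integral => p _; rewrite !indicE.
      suff -> : (p.2 \in [set u]) = (p \in snd @^-1` [set u]) by [].
      by apply/idP/idP => /set_mem ?; exact/mem_set.
    - apply/measurable_EFinP.
      exact: (measurableT_comp (@measurable_indic _ _ R setT [set u] _) measurable_snd).
  transitivity (\int[P]_(o in V @^-1` [set u]) phi u (Zv o)).
    rewrite [RHS]integral_mkcond; apply: eq_integral => o _.
    rewrite patchE /f/= indicE.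
    have -> : (V o \in [set u]) = (o \in V @^-1` [set u]).
      by apply/idP/idP => /set_mem ?; exact/mem_set.
    by case: ifP; rewrite ?mule1 ?mule0.
  rewrite (ge0_integral_indep mZv (preimage_measurable mV _) (f := phi u))//.
    by rewrite phiE Vlaw.
  by move=> A mA; exact: ZV_indep.
have mNphi u : measurable_fun setT (fun o => N u (Zv o) * phi u (Zv o)).
  by apply: emeasurable_funM; [exact: (measurableT_comp (mN u))|exact: (measurableT_comp (mphi u))].
under eq_fun do rewrite QE.
split; first exact: emeasurable_funD.
rewrite prod_integral// ge0_integralD//.
- by rewrite !NphiE.
- by move=> o _; rewrite mule_ge0.
- by move=> o _; rewrite mule_ge0.
Qed.

End LossTest.

(* [KL (kappa z) _] need not be measurable in [z] when the space [T] is not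
   countably generated; only its measurable pointwise lower bound is integrated. *)
Lemma MI_le_CMI : MI P L V <= CMI P Zv kappa.
Proof.
have [h [Ph h2 KLE]] := KL_bounded_density (ler0n R 2) joint_le.
rewrite (MI_KL P mL mV) -/joint -/prod KLE.
have [mh h0 _] := Ph.
apply/lee_addgt0Pr => e e0.
(* Since [h + e >= e], this shift makes [ln (h + e)] nonnegative, so that the disintegration lemmas
   for nonnegative functions apply; it cancels at the end. *)
pose c := (- ln e)%R.
pose g (p : R * bool) := (h p + e)%R.
have mg : measurable_fun setT g by apply: measurable_funD.
have geM p : (e <= g p <= 2 + e)%R by rewrite /g lerDr h0 lerD2r h2.
have g0 p : (0 < g p)%R by have /andP[eg _] := geM p; exact: lt_le_trans eg.
have gM p : (`|g p| <= 2 + e)%R by have /andP[_] := geM p; rewrite gtr0_norm.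
pose lg p := ln (g p).
have mlg : measurable_fun setT lg by exact: measurable_ln_comp.
have lgc p : (0 <= lg p + c)%R.
  have /andP[eg _] := geM p.
  by rewrite subr_ge0 ler_ln ?posrE.
have lgM p : (`|lg p| <= `|ln e| + `|ln (2 + e)|)%R.
  have /andP[eg gM'] := geM p.
  have l1 : (ln e <= lg p)%R by rewrite ler_ln ?posrE.
  have l2 : (lg p <= ln (2 + e))%R by rewrite ler_ln ?posrE// addr_gt0.
  have := ler_norm (ln (2 + e)); have := ler_norm (- ln e)%R; rewrite normrN.
  have := normr_ge0 (ln (2 + e)); have := normr_ge0 (ln e).
  by rewrite ler_norml; lra.
have mEg : measurable_fun setT (EFin \o g) by exact/measurable_EFinP.
have mElg : measurable_fun setT (fun p => (lg p + c)%:E).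
  by apply/measurable_EFinP; exact: measurable_funD.
have Eg0 p : 0 <= (EFin \o g) p by rewrite lee_fin ltW.
have Elg0 p : 0 <= (lg p + c)%:E by rewrite lee_fin.
have [mA AE] := joint_integral mElg Elg0.
have [mB BE] := marginals_integral mEg Eg0.
set a := fun o => _ in mA; set b := fun o => _ in mB.
have jointE : \int[joint]_p (lg p + c)%:E =
    (\int[prod]_p (h p * lg p) + c)%:E.
  by rewrite (integral_shift joint c mlg lgM) (Rintegral_density Ph mlg lgM).
have hi : prod.-integrable setT (EFin \o h).
  apply: (bounded_integrable prod mh (M := 2)) => p.
  by rewrite ger0_norm.
have prodE : \int[prod]_p (EFin \o g) p = (1 + e)%:E.
  have h2' p : (`|h p| <= 2)%R by rewrite ger0_norm.
  rewrite [LHS](integral_shift prod e mh h2'); congr (_ + _)%:E.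
  rewrite -(Rintegral1 joint) (Rintegral_density (M := 1) Ph)//.
    by apply: eq_Rintegral => p _; rewrite mulr1.
  by move=> p; rewrite normr1.
have a0 o : 0 <= a o by exact: integral_ge0.
have b0 o : 0 <= b o by exact: integral_ge0.
have aint : P.-integrable setT a.
  apply/integrableP; split => //; under eq_integral do rewrite gee0_abs//.
  by rewrite /a -AE jointE ltry.
have bint : P.-integrable setT b.
  apply/integrableP; split => //; under eq_integral do rewrite gee0_abs//.
  by rewrite /b -BE prodE ltry.
have cint : P.-integrable setT (cst (c - 1)%:E).
  exact: finite_measure_integrable_cst.
have bcint := integrableD measurableT bint cint.
(* [a o] carries the shift [c]; subtracting [c - 1] along with [b o] removes it and restores the
   constant 1 of the variational bound. *)
have lower : \int[P]_o (a o - (b \+ cst (c - 1)%:E) o) <= CMI P Zv kappa.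
  rewrite CMI_KL; apply: integral_mono => o.
  pose z := Zv o.
  pose kz := pker_probability kappa z.
  pose qz := margins z.
  have mpz : measurable_fun setT (fun p : T * bool => (psi z p.1, p.2)).
    apply: measurable_fun_pair => //.
    have m1 : measurable_fun setT (fun p : T * bool => (z, p.1)).
      exact: measurable_fun_pair.
    exact: (measurableT_comp mpsi m1).
  have mgz := measurableT_comp mg mpz.
  have mlgz := measurableT_comp mlg mpz.
  have := @KL_ge_variational _ _ _ kz qz _ _ _ e0 mgz (fun p => geM _).
  apply: le_trans.
  have -> : a o = (\int[kz]_p lg (psi z p.1, p.2) + c)%:E.
    exact: (integral_shift kz c mlgz (fun p => lgM _)).
  have -> : b o = (\int[qz]_p g (psi z p.1, p.2) + 0)%:E.
    rewrite -(integral_shift qz 0%R mgz (fun p => gM _)).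
    by under [RHS]eq_integral do rewrite addr0.
  rewrite lee_fin /lg/=; lra.
(* Adding [e] inside the logarithm only increases it, and where [h] vanishes both integrands are
   0. *)
apply: (@le_trans _ _ (\int[prod]_p (h p * lg p))%R%:E).
  have hlgi := integrable_density Ph mlg lgM.
  rewrite /Rintegral fineK; last exact: (integrable_fin_num measurableT hlgi).
  apply: integral_mono => p; rewrite lee_fin.
  have := h0 p; rewrite le_eqVlt => /predU1P[<-|hp]; first by rewrite !mul0r.
  by rewrite ler_pM2l// ler_ln ?posrE// lerDl ltW.
rewrite -leeBlDr//; apply: le_trans lower.
rewrite (integralB measurableT aint bcint) (integralD measurableT bint cint).
have -> : \int[P]_o a o = (\int[prod]_p (h p * lg p) + c)%:E.
  by rewrite -jointE AE.
have -> : \int[P]_o b o = (1 + e)%:E by rewrite -prodE BE.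
have -> : \int[P]_o cst (c - 1)%:E o = (c - 1)%:E.
  by rewrite integral_cst// [X in _ * X](probability_setT P) mule1.
rewrite /= lee_fin; lra.
Qed.

End MILeCMI.

Lemma supersample_indep_selector (R : realType) (dO dX dY dW : measure_display)
    (O : measurableType dO) (X : measurableType dX) (Y : measurableType dY)
    (Wt : measurableType dW) (n : nat) (P : probability O R)
    (mu : probability (X * Y)%type R)
    (Alg : R.-pker (n.-tuple (X * Y)%type) ~> Wt)
    (Zt : O -> n.-tuple ((X * Y) * (X * Y))) (U : O -> n.-tuple bool)
    (W : O -> Wt) (i : 'I_n) C (b : bool) :
  measurable_fun setT Zt -> measurable_fun setT U ->
  supersample_model P mu Alg Zt U W -> measurable C ->
  (P (Zt @^-1` C `&` (fun o => tnth (U o) i) @^-1` [set b]) =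
   P (Zt @^-1` C) * P ((fun o => tnth (U o) i) @^-1` [set b]))%E.
Proof.
move=> mZt mU model mC.
have mUb := measurable_Uev mU i b.
have mZC := preimage_measurable mZt mC.
rewrite (sum_over_U P mU (measurableI _ _ mZC mUb)) (sum_over_U P mU mUb).
rewrite ge0_mule_fsumr//; apply: eq_fsbigr => u _.
have [ub|ub] := eqVneq (tnth u i) b.
  have E : (fun o => tnth (U o) i) @^-1` [set b] `&` U @^-1` [set u] = U @^-1` [set u].
    by apply/seteqP; split=> [ o []//|o uo]; split=> //=; rewrite -ub -uo.
  by rewrite -setIA E (supersample_indep_U mZt mU model).
have E : (fun o => tnth (U o) i) @^-1` [set b] `&` U @^-1` [set u] = set0.
  by apply/seteqP; split=> // o [/= ob uo]; move: ub; rewrite -uo ob eqxx.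
by rewrite -setIA E setI0 !measure0 mule0.
Qed.

Unset Implicit Arguments.

Theorem theorem6 (R : realType) (dO dX dY dW : measure_display)
  (O : measurableType dO) (X : measurableType dX) (Y : measurableType dY)
  (Wt : measurableType dW) (P : probability O R) (n : nat)
  (mu : probability (X * Y)%type R)
  (f : Wt -> X -> Y) (lossp : Y -> Y -> R)
  (Alg : R.-pker (n.-tuple (X * Y)%type) ~> Wt)
  (Zt : O -> n.-tuple ((X * Y) * (X * Y))) (U : O -> n.-tuple bool)
  (W : O -> Wt) :
  (0 < n)%N ->
  measurable_fun setT (fun p : Wt * X => f p.1 p.2) ->
  measurable_fun setT (fun p : Y * Y => lossp p.1 p.2) ->
  (forall w x y, 0 <= lossp (f w x) y <= 1) ->
  measurable_fun setT Zt -> measurable_fun setT U -> measurable_fun setT W ->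
  supersample_model P mu Alg Zt U W ->
  let loss := fun (w : Wt) (z : X * Y) => lossp (f w z.1) z.2 in
  let Lmu := (\int[P]_o \int[mu]_z (loss (W o) z)%:E)%E in
  let Ln := (\int[P]_o ((n%:R)^-1 *
      \sum_(i < n) loss (W o) (tnth (select_sample (Zt o) (U o)) i))%:E)%E in
  let Err := (Lmu - Ln)%E in
  let Lplus := fun (i : 'I_n) (o : O) => loss (W o) (tnth (Zt o) i).1 in
  let Ui := fun (i : 'I_n) (o : O) => tnth (U o) i in
  let fWX := fun (i : 'I_n) (o : O) => f (W o) (tnth (Zt o) i).1.1 in
  (`| Err | <= (2 / n%:R)%:E *
      \sum_(i < n) sqrte (2%:E * MI P (Lplus i) (Ui i)))%E /\
  (forall kappa : 'I_n -> R.-pker (n.-tuple ((X * Y) * (X * Y))%type) ~> (Y * bool)%type,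
     (forall i, cond_law P Zt (fun o => (fWX i o, Ui i o)) (kappa i)) ->
     ((2 / n%:R)%:E * \sum_(i < n) sqrte (2%:E * MI P (Lplus i) (Ui i)) <=
      (2 / n%:R)%:E * \sum_(i < n) sqrte (2%:E * CMI P Zt (kappa i)))%E).
Proof.
move=> n0 mf mlossp loss01 mZt mU mW model loss Lmu Ln Err Lplus Ui fWX.
have mell : measurable_fun setT (fun p : Wt * (X * Y) => loss p.1 p.2).
  apply: (measurableT_comp mlossp (g := fun p : Wt * (X * Y) => (f p.1 p.2.1, p.2.2))).
  apply: measurable_fun_pair; last exact: measurableT_comp.
  apply: (measurableT_comp mf (g := fun p : Wt * (X * Y) => (p.1, p.2.1))).
  by apply: measurable_fun_pair => //; exact: measurableT_comp.
have ell0 w z : 0 <= loss w z by have /andP[] := loss01 w z.1 z.2.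
have ell1 w z : loss w z <= 1 by have /andP[] := loss01 w z.1 z.2.
split.
  exact: (generalization_error_le mZt mU mW model mell ell0 ell1 n0).
move=> kappa kappaP.
apply: lee_wpmul2l; first by rewrite lee_fin.
apply: lee_sum => i _.
have mZi : measurable_fun setT (fun z : n.-tuple ((X * Y) * (X * Y)) => (tnth z i).1).
  exact: (measurable_zproj i false).
have mF : measurable_fun setT (fWX i).
  apply: (measurableT_comp mf (g := fun o => (W o, (tnth (Zt o) i).1.1))).
  apply: measurable_fun_pair => //.
  exact: (measurableT_comp measurable_fst (measurableT_comp mZi mZt)).
(* The label of the point is read off the supersample, so the prediction is the only other argument
   of the loss. *)
have mpsi : measurable_fun setT (fun p : n.-tuple ((X * Y) * (X * Y)) * Y =>
    lossp p.2 (tnth p.1 i).1.2).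
  apply: (measurableT_comp mlossp (g := fun p => (p.2, (tnth p.1 i).1.2))).
  apply: measurable_fun_pair => //.
  exact: (measurableT_comp measurable_snd (measurableT_comp mZi measurable_fst)).
have MICMI := MI_le_CMI (psi := fun z y => lossp y (tnth z i).1.2)
  mZt mF (measurable_tnthU mU i) mpsi (fun b => Uev_probability mU model i b)
  (fun C b mC => supersample_indep_selector i b mZt mU model mC) (kappaP i).
rewrite lee_sqrt; last by rewrite mule_ge0 ?lee_fin// CMI_ge0.
by rewrite lee_pmul2l.
Qed.
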